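(* Let $(P,\mathfrak p,k)$ be a local ring and let $P\to Q$ be a homomorphism of commutative rings such that $Q$ is a finite free $P$-module and there exists a prime ideal $\mathfrak q$ of $P$ for which the ring $k(\mathfrak q)\otimes_P Q$ is Gorenstein, where $k(\mathfrak q)=P_{\mathfrak q}/\mathfrak qP_{\mathfrak q}$. Set $R=Q/\mathfrak pQ$. If $\operatorname{Ext}^1_R(\operatorname{Hom}_k(R,k),R)=0$, then the ring $R$ is Gorenstein and the $P$-algebra $Q$ is Frobenius.
   Context: A local ring $(P,\mathfrak p,k)$ is a commutative noetherian ring $P$ with unique maximal ideal $\mathfrak p$ and residue field $k=P/\mathfrak p$. For a homomorphism of commutative rings $P\to Q$, the $P$-module $\operatorname{Hom}_P(Q,P)$ is a $Q$-module via the canonical action $(q\varphi)(x)=\varphi(qx)$; in particular $\operatorname{Hom}_k(R,k)$ is an $R$-module in this way. The $P$-algebra $Q$ is Frobenius if $Q$ is a finite free $P$-module and there is a $Q$-linear isomorphism $\operatorname{Hom}_P(Q,P)\cong Q$. A commutative noetherian ring (not necessarily local) is Gorenstein if all of its localizations at prime ideals are Gorenstein local rings. *)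

(* Defs.v *)
From HB Require Import structures.
From mathcomp Require Import all_boot all_algebra generic_quotient ring.
From mathcomp Require Import boolp classical_sets.

Set Implicit Arguments.
Unset Strict Implicit.
Unset Printing Implicit Defensive.

Import GRing.Theory.
Local Open Scope ring_scope.
Local Open Scope quotient_scope.

(* Rings are [comPzRingType]s, so that the zero ring is allowed; ideals are
   classical sets, and a homomorphism of rings, not a MathComp algebra
   structure, carries each base change, because MathComp algebras are
   nonzero. *)

Definition ideal (R : comPzRingType) (I : set R) : Prop :=
  [/\ I 0, forall x y, I x -> I y -> I (x + y) & forall a x, I x -> I (a * x)].

Definition maximal_ideal (R : comPzRingType) (m : set R) : Prop :=
  [/\ ideal m, ~ m 1 &
      forall J : set R, ideal J -> ~ J 1 -> (m `<=` J)%classic -> J = m].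

Record prime_ideal (R : comPzRingType) := PrimeIdeal {
  prime_set :> set R;
  prime_ideal_ideal : ideal prime_set;
  prime_ideal_proper : ~ prime_set 1;
  prime_ideal_mul : forall x y,
    prime_set (x * y) -> prime_set x \/ prime_set y }.

Definition noetherian (R : comPzRingType) : Prop :=
  forall I : set R, ideal I ->
    exists (n : nat) (g : 'I_n -> R),
      forall x, I x <-> exists c : 'I_n -> R, x = \sum_i c i * g i.

Definition local_ring (R : comPzRingType) (m : set R) : Prop :=
  [/\ noetherian R, maximal_ideal m &
      forall m' : set R, maximal_ideal m' -> m' = m].

(* The ideal I S of S generated by the image of I under f : R -> S. *)
Definition extended_ideal (R S : comPzRingType) (f : R -> S) (I : set R)
    : set S :=
  fun x => exists (n : nat) (s : 'I_n -> S) (a : 'I_n -> R),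
    (forall i, I (a i)) /\ x = \sum_i s i * f (a i).

(* pi exhibits S as the quotient ring R / I. *)
Definition quotient_map (R S : comPzRingType) (pi : {rmorphism R -> S})
    (I : set R) : Prop :=
  (forall y, exists x, pi x = y) /\ (forall x, pi x = 0 <-> I x).

(* The ring of fractions S^-1 R, where a / s = b / t when u (a t) = u (b s)
   for some u in S. *)
Section Localization.

Variables (R : comPzRingType) (S : mulrClosed R).

Definition denom := {s : R | s \in S}.

Definition denom1 : denom := exist _ 1 (rpred1 S).
Definition denomM (s t : denom) : denom :=
  exist _ (val s * val t) (rpredM (valP s) (valP t)).

Definition loc_rel (x y : R * denom) : bool :=
  `[< exists2 u, u \in S & u * (x.1 * val y.2) = u * (y.1 * val x.2) >].

Lemma loc_relP x y :
  reflect (exists2 u, u \in S & u * (x.1 * val y.2) = u * (y.1 * val x.2))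
          (loc_rel x y).
Proof. exact: asboolP. Qed.

Lemma loc_rel_refl : reflexive loc_rel.
Proof. by move=> x; apply/asboolP; exists 1; rewrite ?rpred1. Qed.

Lemma loc_rel_sym : symmetric loc_rel.
Proof.
by move=> x y; apply/asboolP/asboolP => -[u uS e]; exists u; rewrite // e.
Qed.

Lemma loc_rel_trans : transitive loc_rel.
Proof.
move=> y x z /asboolP[u uS e] /asboolP[v vS e']; apply/asboolP.
exists (u * v * val y.2); first by rewrite !rpredM // (valP y.2).
transitivity (v * val z.2 * (u * (x.1 * val y.2))); first by ring.
rewrite e; transitivity (u * val x.2 * (v * (y.1 * val z.2))); first by ring.
by rewrite e'; ring.
Qed.

Canonical loc_equiv := EquivRel loc_rel loc_rel_refl loc_rel_sym loc_rel_trans.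

Definition localization := {eq_quot loc_rel}.

HB.instance Definition _ : EqQuotient _ loc_rel localization :=
  EqQuotient.on localization.
HB.instance Definition _ := Choice.on localization.

Definition loc_mk (a : R) (s : denom) : localization := \pi_localization (a, s).

Lemma loc_mk_eq a s b t :
  loc_mk a s = loc_mk b t <->
  exists2 u, u \in S & u * (a * val t) = u * (b * val s).
Proof.
rewrite /loc_mk; split; first by move/eqmodP/loc_relP.
by move=> h; apply/eqmodP/loc_relP.
Qed.

Lemma loc_mkP (x : localization) : exists a s, x = loc_mk a s.
Proof. by elim/quotW: x => -[a s]; exists a, s. Qed.

Definition loc_add (x y : localization) : localization :=
  loc_mk ((repr x).1 * val (repr y).2 + (repr y).1 * val (repr x).2)
         (denomM (repr x).2 (repr y).2).
Definition loc_opp (x : localization) : localization :=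
  loc_mk (- (repr x).1) (repr x).2.
Definition loc_mul (x y : localization) : localization :=
  loc_mk ((repr x).1 * (repr y).1) (denomM (repr x).2 (repr y).2).

Lemma loc_repr a s :
  exists2 u, u \in S & u * ((repr (loc_mk a s)).1 * val s) =
                       u * (a * val (repr (loc_mk a s)).2).
Proof.
apply/loc_mk_eq; rewrite -[RHS]reprK /loc_mk; congr (\pi _).
by case: (repr _).
Qed.

Lemma loc_addE a s b t :
  loc_add (loc_mk a s) (loc_mk b t) =
  loc_mk (a * val t + b * val s) (denomM s t).
Proof.
apply/loc_mk_eq; have [u uS e] := loc_repr a s; have [v vS e'] := loc_repr b t.
exists (u * v); first exact: rpredM.
move: (repr _) (repr _) e e' => [b' t'] [a' s'] /= e e'.
transitivity (v * sval t * sval t' * (u * (a' * sval s)) +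
              u * sval s * sval s' * (v * (b' * sval t))); first by ring.
by rewrite e e'; ring.
Qed.

Lemma loc_oppE a s : loc_opp (loc_mk a s) = loc_mk (- a) s.
Proof.
apply/loc_mk_eq; have [u uS e] := loc_repr a s; exists u => //.
by rewrite !mulNr !mulrN e.
Qed.

Lemma loc_mulE a s b t :
  loc_mul (loc_mk a s) (loc_mk b t) = loc_mk (a * b) (denomM s t).
Proof.
apply/loc_mk_eq; have [u uS e] := loc_repr a s; have [v vS e'] := loc_repr b t.
exists (u * v); first exact: rpredM.
move: (repr _) (repr _) e e' => [b' t'] [a' s'] /= e e'.
transitivity ((u * (a' * sval s)) * (v * (b' * sval t))); first by ring.
by rewrite e e'; ring.
Qed.

Lemma loc_mk_eq1 a s b t : a * val t = b * val s -> loc_mk a s = loc_mk b t.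
Proof. by move=> e; apply/loc_mk_eq; exists 1; rewrite ?rpred1 ?e. Qed.

Lemma loc_addA : associative loc_add.
Proof.
move=> x y z; have [[a [s ->]] [b [t ->]]] := (loc_mkP x, loc_mkP y).
have [c [r ->]] := loc_mkP z.
by rewrite !loc_addE; apply: loc_mk_eq1 => /=; ring.
Qed.

Lemma loc_addC : commutative loc_add.
Proof.
move=> x y; have [[a [s ->]] [b [t ->]]] := (loc_mkP x, loc_mkP y).
by rewrite !loc_addE; apply: loc_mk_eq1 => /=; ring.
Qed.

Lemma loc_add0 : left_id (loc_mk 0 denom1) loc_add.
Proof.
move=> x; have [a [s ->]] := loc_mkP x.
by rewrite loc_addE; apply: loc_mk_eq1 => /=; ring.
Qed.

Lemma loc_addN : left_inverse (loc_mk 0 denom1) loc_opp loc_add.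
Proof.
move=> x; have [a [s ->]] := loc_mkP x.
by rewrite loc_oppE loc_addE; apply: loc_mk_eq1 => /=; ring.
Qed.

HB.instance Definition _ :=
  GRing.isZmodule.Build localization loc_addA loc_addC loc_add0 loc_addN.

Lemma loc_mulA : associative loc_mul.
Proof.
move=> x y z; have [[a [s ->]] [b [t ->]]] := (loc_mkP x, loc_mkP y).
have [c [r ->]] := loc_mkP z.
by rewrite !loc_mulE; apply: loc_mk_eq1 => /=; ring.
Qed.

Lemma loc_mulC : commutative loc_mul.
Proof.
move=> x y; have [[a [s ->]] [b [t ->]]] := (loc_mkP x, loc_mkP y).
by rewrite !loc_mulE; apply: loc_mk_eq1 => /=; ring.
Qed.

Lemma loc_mul1 : left_id (loc_mk 1 denom1) loc_mul.
Proof.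
move=> x; have [a [s ->]] := loc_mkP x.
by rewrite loc_mulE; apply: loc_mk_eq1 => /=; ring.
Qed.

Lemma loc_mulDl : left_distributive loc_mul loc_add.
Proof.
move=> x y z; have [[a [s ->]] [b [t ->]]] := (loc_mkP x, loc_mkP y).
have [c [r ->]] := loc_mkP z.
by rewrite !(loc_mulE, loc_addE); apply: loc_mk_eq1 => /=; ring.
Qed.

HB.instance Definition _ :=
  GRing.Zmodule_isComPzRing.Build localization
    loc_mulA loc_mulC loc_mul1 loc_mulDl.

Definition to_loc (a : R) : localization := loc_mk a denom1.

Lemma to_loc_is_zmod_morphism : zmod_morphism to_loc.
Proof.
move=> a b; rewrite /to_loc -[RHS]/(loc_add _ (loc_opp _)).
by rewrite loc_oppE loc_addE; apply: loc_mk_eq1 => /=; ring.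
Qed.

Lemma to_loc_is_monoid_morphism : monoid_morphism to_loc.
Proof.
split=> // a b; rewrite /to_loc -[RHS]/(loc_mul _ _).
by rewrite loc_mulE; apply: loc_mk_eq1 => /=; ring.
Qed.

HB.instance Definition _ :=
  GRing.isZmodMorphism.Build R localization to_loc to_loc_is_zmod_morphism.
HB.instance Definition _ :=
  GRing.isMonoidMorphism.Build R localization to_loc to_loc_is_monoid_morphism.

End Localization.

Section LocalizationAtPrime.

Variables (R : comPzRingType) (q : prime_ideal R).

Definition prime_compl : {pred R} := fun x => `[< ~ prime_set q x >].

Lemma prime_compl_mulr_closed : mulr_closed prime_compl.
Proof.
split; first by apply/asboolP/prime_ideal_proper.
move=> x y /asboolP nqx /asboolP nqy; apply/asboolP.
by case/prime_ideal_mul.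
Qed.

HB.instance Definition _ :=
  GRing.isMulClosed.Build R prime_compl prime_compl_mulr_closed.

Definition loc_at : comPzRingType := localization prime_compl.

Definition to_loc_at : {rmorphism R -> loc_at} := @to_loc R prime_compl.

End LocalizationAtPrime.

Section Homological.

Variable R : comPzRingType.

Definition injective_module (E : lmodType R) : Prop :=
  forall (A B : lmodType R) (i : {linear A -> B}) (g : {linear A -> E}),
    injective i -> exists h : {linear B -> E}, forall x, h (i x) = g x.

Definition projective_module (F : lmodType R) : Prop :=
  forall (A B : lmodType R) (s : {linear A -> B}) (g : {linear F -> B}),
    (forall y, exists x, s x = y) ->
    exists h : {linear F -> A}, forall x, s (h x) = g x.

(* 0 -> M -> E 0 -> E 1 -> ... *)
Definition injective_resolution (M : lmodType R) (E : nat -> lmodType R)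
    (eta : {linear M -> E 0}) (d : forall n, {linear E n -> E n.+1}) : Prop :=
  [/\ forall n, injective_module (E n),
      injective eta,
      forall x, d 0 x = 0 <-> exists y, eta y = x &
      forall n x, d n.+1 x = 0 <-> exists y, d n y = x].

Definition finite_injective_dimension (M : lmodType R) : Prop :=
  exists (E : nat -> lmodType R) (eta : {linear M -> E 0})
         (d : forall n, {linear E n -> E n.+1}),
    injective_resolution eta d /\
    exists N, forall n, (N < n)%N -> forall x : E n, x = 0.

(* ... -> F 1 -> F 0 -> M -> 0 *)
Definition projective_resolution (M : lmodType R) (F : nat -> lmodType R)
    (eps : {linear F 0 -> M}) (d : forall n, {linear F n.+1 -> F n}) : Prop :=
  [/\ forall n, projective_module (F n),
      forall y, exists x, eps x = y,
      forall x, eps x = 0 <-> exists y, d 0 y = x &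
      forall n x, d n x = 0 <-> exists y, d n.+1 y = x].

Definition hom_cocycle (F : nat -> lmodType R)
    (d : forall n, {linear F n.+1 -> F n}) (N : lmodType R) (n : nat)
    (h : {linear F n -> N}) : Prop :=
  forall x, h (d n x) = 0.

Definition hom_coboundary (F : nat -> lmodType R)
    (d : forall n, {linear F n.+1 -> F n}) (N : lmodType R) (n : nat) :
    {linear F n -> N} -> Prop :=
  match n with
  | 0 => fun h => forall x, h x = 0
  | m.+1 => fun h => exists g : {linear F m -> N}, forall x, h x = g (d m x)
  end.

(* Ext^n_R(M, N) = H^n(Hom_R(F, N)) for a projective resolution F of M; by the
   comparison theorem its vanishing does not depend on F. *)
Definition Ext_vanishes (n : nat) (M N : lmodType R) : Prop :=
  exists (F : nat -> lmodType R) (eps : {linear F 0 -> M})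
         (d : forall n, {linear F n.+1 -> F n}),
    projective_resolution eps d /\
    forall h : {linear F n -> N}, hom_cocycle d h -> hom_coboundary d h.

End Homological.

Definition gorenstein_local (R : comPzRingType) : Prop :=
  (exists m : set R, local_ring m) /\ finite_injective_dimension R^o.

Definition gorenstein (R : comPzRingType) : Prop :=
  noetherian R /\ forall q : prime_ideal R, gorenstein_local (loc_at q).

(* T, with i and j, is the ring B \otimes_A C for g : A -> B and f : A -> C:
   its additive group is the universal target of an A-balanced biadditive map,
   b \otimes c being i b * j c. *)
Definition is_tensor_product (A B C T : comPzRingType)
    (g : A -> B) (f : A -> C)
    (i : {rmorphism B -> T}) (j : {rmorphism C -> T}) : Prop :=
  (forall a, i (g a) = j (f a)) /\
  forall (M : zmodType) (beta : B -> C -> M),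
    (forall b b' c, beta (b + b') c = beta b c + beta b' c) ->
    (forall b c c', beta b (c + c') = beta b c + beta b c') ->
    (forall b a c, beta (b * g a) c = beta b (f a * c)) ->
    exists2 h : {additive T -> M},
      forall b c, h (i b * j c) = beta b c &
      forall h' : {additive T -> M},
        (forall b c, h' (i b * j c) = beta b c) -> h' =1 h.

Section RelativeDual.

Variables (P Q : comPzRingType) (f : {rmorphism P -> Q}).

(* Hom_P(Q, P), where Q is a P-module through f, with the Q-module structure
   (q phi)(x) = phi (q x). *)
Record dual := Dual {
  dual_fun :> Q -> P;
  dualD : forall x y, dual_fun (x + y) = dual_fun x + dual_fun y;
  dualZ : forall a x, dual_fun (f a * x) = a * dual_fun x }.

HB.instance Definition _ := gen_eqMixin dual.
HB.instance Definition _ := gen_choiceMixin dual.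

Lemma dual_eqP (phi psi : dual) : phi =1 psi -> phi = psi.
Proof.
case: phi psi => [u uD uZ] [v vD vZ] /= /funext uv; case: v / uv in vD vZ *.
by congr Dual; exact: Prop_irrelevance.
Qed.

Program Definition dual_zero := @Dual (fun=> 0) _ _.
Next Obligation. by rewrite addr0. Qed.
Next Obligation. by rewrite mulr0. Qed.

Program Definition dual_opp (phi : dual) := @Dual (fun x => - phi x) _ _.
Next Obligation. by rewrite dualD opprD. Qed.
Next Obligation. by rewrite dualZ mulrN. Qed.

Program Definition dual_add (phi psi : dual) :=
  @Dual (fun x => phi x + psi x) _ _.
Next Obligation. by rewrite !dualD addrACA. Qed.
Next Obligation. by rewrite !dualZ mulrDr. Qed.

Program Definition dual_scale (q : Q) (phi : dual) :=
  @Dual (fun x => phi (q * x)) _ _.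
Next Obligation. by rewrite mulrDr dualD. Qed.
Next Obligation. by rewrite mulrCA dualZ. Qed.

Lemma dual_addA : associative dual_add.
Proof. by move=> u v w; apply: dual_eqP => x /=; rewrite addrA. Qed.

Lemma dual_addC : commutative dual_add.
Proof. by move=> u v; apply: dual_eqP => x /=; rewrite addrC. Qed.

Lemma dual_add0 : left_id dual_zero dual_add.
Proof. by move=> u; apply: dual_eqP => x /=; rewrite add0r. Qed.

Lemma dual_addN : left_inverse dual_zero dual_opp dual_add.
Proof. by move=> u; apply: dual_eqP => x /=; rewrite addNr. Qed.

HB.instance Definition _ :=
  GRing.isZmodule.Build dual dual_addA dual_addC dual_add0 dual_addN.

Lemma dual_scaleA a b phi :
  dual_scale a (dual_scale b phi) = dual_scale (a * b) phi.
Proof. by apply: dual_eqP => x /=; rewrite mulrCA mulrA. Qed.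

Lemma dual_scale1 : left_id 1 dual_scale.
Proof. by move=> phi; apply: dual_eqP => x /=; rewrite mul1r. Qed.

Lemma dual_scaleDr : right_distributive dual_scale +%R.
Proof. by move=> a u v; apply: dual_eqP. Qed.

Lemma dual_scaleDl phi : {morph dual_scale^~ phi : a b / a + b}.
Proof. by move=> a b; apply: dual_eqP => x /=; rewrite mulrDl dualD. Qed.

HB.instance Definition _ :=
  GRing.Zmodule_isLmodule.Build Q dual
    dual_scaleA dual_scale1 dual_scaleDr dual_scaleDl.

Definition finite_free : Prop :=
  exists (n : nat) (e : 'I_n -> Q),
    forall x, exists! c : {ffun 'I_n -> P}, x = \sum_i f (c i) * e i.

Definition frobenius : Prop :=
  finite_free /\ exists h : {linear dual -> Q^o}, bijective h.

End RelativeDual.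

(* Main.v *)
Require Import Defs.
From HB Require Import structures.
From mathcomp Require Import all_boot all_algebra ring.
From mathcomp Require Import boolp classical_sets.

Set Implicit Arguments.
Unset Strict Implicit.
Unset Printing Implicit Defensive.

Import GRing.Theory.
Local Open Scope ring_scope.

(** Let D = Hom_P(Q, P). It is free over P on a dual basis, and its base changes
    along P -> k and P -> K are D_R = Hom_k(R, k) and D_T = Hom_K(T, K). The
    argument compares the modules Hom_Q(D, Q), Hom_R(D_R, R) and Hom_T(D_T, T).
    In a basis e_i of Q over P, a homomorphism D -> Q is an element of
    Q (x)_P Q, with coefficients B_ij, on which the two actions of Q agree: a
    Casimir element. This is a system of linear equations on the matrix B whose
    coefficients are the structure constants of Q, so it makes sense over P, k
    and K alike.

    Casimir elements form the kernel of the first differential in a complex of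
    finite free P-modules, the bar complex computing Ext_Q(D, Q). The complex
    commutes with base change, and over k its cohomology in degree 1 is
    Ext^1_R(D_R, R) = 0. A complex of finite free modules over a local ring
    which is exact in one degree over the residue field splits there, so
    every Casimir element over k lifts to P ([lift_casimir_of_Ext]).

    Over K all Casimir matrices are symmetric ([casimir_sym_of_gorenstein]). For
    a Gorenstein algebra T the localizations at maximal ideals are artinian of
    finite injective dimension, so their socles are simple
    ([finite_injective_dimension_socle]); hence D_T is generated by one
    functional tau, and a T-linear map h on D_T pairs a tau with b tau to
    tau(a b h(tau)).

    An element of P with zero image in K is not a unit, so it lies in p. For a
    Casimir matrix B over P the entries of B - B^T vanish in K, hence in k, and
    therefore all Casimir matrices of R over k are symmetric. A simple module
    occurring twice in the socle of R would give an asymmetric one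
    ([multiplicity_free_socle_of_casimir_sym]), so the socle of R is
    multiplicity free and there is a functional tau on R that vanishes on no
    nonzero ideal ([ex_nondegenerate_form]). The form tau(a b) is then
    nondegenerate, which makes the localizations of R self-injective
    ([gorenstein_of_form]). Any lift of tau to Q has a Gram determinant which is
    a unit, so it generates D freely ([frobenius_of_gram]). *)

(** * Ideals and rings of finite length *)

Lemma ex_maximal (T : Type) (P : T -> Prop) (f : T -> nat) N :
  (exists t, P t) -> (forall t, P t -> (f t <= N)%N) ->
  exists2 t, P t & forall t', P t' -> (f t' <= f t)%N.
Proof.
move=> [t0 Pt0] fN; pose V k := `[< exists2 t, P t & f t = k >].
have exV : exists k, V k by exists (f t0); apply/asboolP; exists t0.
have leV k : V k -> (k <= N)%N by move=> /asboolP[t Pt <-]; exact: fN.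
have [k /asboolP[t Pt <-] kmax] := ex_maxnP exV leV.
by exists t => // t' Pt'; apply: kmax; apply/asboolP; exists t'.
Qed.

Section Ideals.

Variable A : comPzRingType.
Implicit Types (I J : set A) (s t x y : A).

Lemma ideal0 I : ideal I -> I 0. Proof. by case. Qed.
Lemma idealD I x y : ideal I -> I x -> I y -> I (x + y).
Proof. by case=> _ + _; apply. Qed.
Lemma idealM I a x : ideal I -> I x -> I (a * x).
Proof. by case=> _ _; apply. Qed.
Lemma idealN I x : ideal I -> I x -> I (- x).
Proof. by move=> hI Ix; rewrite -mulN1r; apply: idealM. Qed.
Lemma idealB I x y : ideal I -> I x -> I y -> I (x - y).
Proof. by move=> hI Ix Iy; apply: idealD => //; apply: idealN. Qed.
Lemma ideal_sum I n (F : 'I_n -> A) :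
  ideal I -> (forall i, I (F i)) -> I (\sum_i F i).
Proof.
move=> hI hF; elim/big_ind: _ => //; first exact: ideal0.
by move=> x y Ix Iy; apply: idealD.
Qed.

(** The ideal I + A t; membership is tested by subtracting a multiple of t, so
    that no decomposition has to be chosen. *)
Definition adjoin I t : set A := fun x => exists c, I (x - c * t).

Lemma adjoin_ideal I t : ideal I -> ideal (adjoin I t).
Proof.
move=> hI; split.
- by exists 0; rewrite mul0r subr0; apply: ideal0.
- move=> x y [c Ic] [d Id]; exists (c + d).
  have -> : x + y - (c + d) * t = (x - c * t) + (y - d * t) by ring.
  exact: idealD.
- move=> a x [c Ic]; exists (a * c).
  have -> : a * x - a * c * t = a * (x - c * t) by ring.
  exact: idealM.
Qed.

Lemma sub_adjoin I t x : I x -> adjoin I t x.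
Proof. by exists 0; rewrite mul0r subr0. Qed.

Lemma mem_adjoin I t : ideal I -> adjoin I t t.
Proof. by move=> hI; exists 1; rewrite mul1r subrr; apply: ideal0. Qed.

Definition zero_ideal : set A := fun x => x = 0.

Lemma zero_ideal_ideal : ideal zero_ideal.
Proof.
split; rewrite /zero_ideal => //; first by move=> x y -> ->; rewrite addr0.
by move=> a x ->; rewrite mulr0.
Qed.

(** mu I plays the part of the length of A / I. Strict monotonicity gives both
    chain conditions; a codimension over a field has it, and it passes to
    localizations by contraction of ideals. *)
Definition length_function (mu : set A -> nat) : Prop :=
  forall I J, ideal I -> ideal J -> (I `<=` J)%classic ->
    (exists2 x, J x & ~ I x) -> (mu J < mu I)%N.

Definition finite_length : Prop := exists mu, length_function mu.

(** s generates a simple module A s, equivalently Ann s is a maximal ideal. *)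
Definition simple_elt s : Prop :=
  s <> 0 /\ forall b, b * s <> 0 -> exists c, c * b * s = s.

(** The socle contains each simple module at most once: the s' in the
    condition are the images of s under maps from A s to A. *)
Definition multiplicity_free_socle : Prop :=
  forall s s', simple_elt s -> (forall a, a * s = 0 -> a * s' = 0) ->
    exists c, s' = c * s.

Lemma length_le mu I J : length_function mu -> ideal I -> ideal J ->
  (I `<=` J)%classic -> (mu J <= mu I)%N.
Proof.
move=> hmu hI hJ IJ; have [JI|nJI] := pselect (J `<=` I)%classic.
  suff -> : I = J by [].
  by apply/seteqP.
apply: ltnW; apply: hmu => //.
by have /existsNP[x /not_implyP[Jx nIx]] := nJI; exists x.
Qed.

(** Choosing t with P t and the ideal I + A t minimal forces t to be recovered
    modulo I from every multiple of t that still satisfies P. *)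
Lemma ex_maximal_adjoin I (P : A -> Prop) :
  finite_length -> ideal I -> (exists t, P t) ->
  exists2 t, P t & forall b, P (b * t) -> exists c, I (t - c * b * t).
Proof.
move=> [mu hmu] hI exP.
have hle t : P t -> (mu (adjoin I t) <= mu I)%N.
  move=> _; apply: length_le => //; first exact: adjoin_ideal.
  by move=> x; apply: sub_adjoin.
have [t Pt tmax] := ex_maximal exP hle.
exists t => // b Pbt.
have [[c Ic]|nt] := pselect (adjoin I (b * t) t).
  by exists c; rewrite -mulrA.
have := tmax _ Pbt; rewrite leqNgt => /negP[].
apply: hmu; try exact: adjoin_ideal.
  move=> x [c Ic]; exists (c * b); by rewrite -mulrA.
by exists t => //; apply: mem_adjoin.
Qed.

(** Take A b a minimal among the nonzero principal ideals inside A a. *)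
Lemma ex_simple_multiple a : finite_length -> a <> 0 ->
  exists b, simple_elt (b * a).
Proof.
move=> fl a0.
pose P t := t <> 0 /\ exists b, t = b * a.
have [|t [t0 [b tE]] tmax] :=
  @ex_maximal_adjoin zero_ideal P fl zero_ideal_ideal.
  by exists a; split=> //; exists 1; rewrite mul1r.
exists b; rewrite -tE; split=> // d dt.
have [|c /subr0_eq ct] := tmax d.
  by split=> //; exists (d * b); rewrite tE mulrA.
by exists c.
Qed.

End Ideals.

(** * Finite injective dimension and the socle *)

Section IdealModule.

Variables (A : comPzRingType) (I : set A) (hI : ideal I).

(** The proof that I is an ideal is an argument so that the closure
    properties can be attached to this predicate. *)
Definition ideal_pred of ideal I : {pred A^o} := fun x => `[< I x >].

Lemma ideal_pred_submod : submod_closed (ideal_pred hI).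
Proof.
split; first by apply/asboolP; apply: ideal0.
move=> a x y /asboolP Ix /asboolP Iy; apply/asboolP.
by apply: idealD => //; apply: idealM.
Qed.

HB.instance Definition _ :=
  GRing.isSubmodClosed.Build A A^o (ideal_pred hI) ideal_pred_submod.

Record ideal_module := IdealModule {
  ideal_val :> A^o;
  _ : ideal_val \in ideal_pred hI }.

HB.instance Definition _ := [isSub for ideal_val].
HB.instance Definition _ := [Choice of ideal_module by <:].
HB.instance Definition _ := [SubChoice_isSubLmodule of ideal_module by <:].

Lemma ideal_module_mem (x : ideal_module) : I (ideal_val x).
Proof. by case: x => x /= /asboolP. Qed.

End IdealModule.

Section ExtensionProperty.

Variable A : comPzRingType.

(** Baer's condition for the submodule Z, restricted to the maps on I + A t
    that vanish on I. This fragment of injectivity follows from injectivity,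
    descends along an injective resolution, and is enough to read off the
    socle. *)
Definition extension_property (E : lmodType A) (Z : set E) : Prop :=
  forall (I : set A) (t : A) (y : E), ideal I -> Z y ->
    (forall a, I (a * t) -> a *: y = 0) ->
    exists e, [/\ Z e, forall a, I a -> a *: e = 0 & t *: e = y].

(** The map x + b t |-> b y on I + A t is well defined by the hypothesis on y;
    e is the value at 1 of its extension to A. *)
Lemma injective_extension_property (E : lmodType A) :
  injective_module E -> extension_property (@setT E).
Proof.
move=> injE I t y hI _ hy.
pose hJ := adjoin_ideal t hI.
pose M := ideal_module hJ.
have exg (x : M) : exists b, I (ideal_val x - b * t).
  exact: (ideal_module_mem x).
pose c (x : M) := projT1 (cid (exg x)).
have cP (x : M) : I (ideal_val x - c x * t) := projT2 (cid (exg x)).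
have gE (x : M) b : I (ideal_val x - b * t) -> c x *: y = b *: y.
  move=> Ib; apply/eqP; rewrite -subr_eq0 -scalerBl; apply/eqP/hy.
  have -> : (c x - b) * t =
    (ideal_val x - b * t) - (ideal_val x - c x * t) by ring.
  exact: idealB.
have g_linear : linear (fun x : M => c x *: y).
  move=> a u v /=; rewrite scalerA -scalerDl; apply: gE => /=.
  have -> : a * ideal_val u + ideal_val v - (a * c u + c v) * t =
    a * (ideal_val u - c u * t) + (ideal_val v - c v * t) by ring.
  by apply: idealD => //; apply: idealM.
pose gmix := GRing.isLinear.Build A M E _ (fun x : M => c x *: y) g_linear.
pose g : {linear M -> E} := HB.pack (fun x : M => c x *: y) gmix.
pose i : {linear M -> A^o} := val.
have [h hE] := injE M A^o i g val_inj.
have hval x (Jx : adjoin I t x) b : I (x - b * t) -> x *: h 1 = b *: y.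
  move=> Ib; have Jx' : x \in ideal_pred hJ by apply/asboolP.
  by rewrite -linearZ /= [_ *: _]mulr1 (hE (IdealModule Jx')); apply: gE.
exists (h 1); split=> //.
  move=> a Ia; rewrite (hval _ _ 0) ?scale0r //; first exact: sub_adjoin.
  by rewrite mul0r subr0.
rewrite (hval _ _ 1) ?scale1r //; first exact: mem_adjoin.
by rewrite mul1r subrr; apply: ideal0.
Qed.

(* A is local, and s spans a copy of the residue field inside A. *)
Variables (s : A) (s0 : s <> 0) (flA : finite_length A).
Hypothesis unit_or_kill : forall b, b * s = 0 \/ exists c, c * b = 1.

(** A t minimal modulo I spans a simple submodule of A / I, and the maximal
    ideal, which consists of the b with b s = 0, kills it. *)
Lemma ex_socle_mod (I : set A) : ideal I -> ~ I 1 ->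
  exists2 t, ~ I t & forall b, b * s = 0 -> I (b * t).
Proof.
move=> hI I1.
have [|t It tmax] := ex_maximal_adjoin (P := fun t => ~ I t) flA hI.
  by exists 1.
exists t => // b bs0; apply: contrapT => /tmax[c Ic].
have [cs|[d dE]] := unit_or_kill (1 - c * b).
  apply: s0; have -> : s = (1 - c * b) * s + c * (b * s) by ring.
  by rewrite cs bs0 mulr0 addr0.
apply: It; have -> : t = (d * (1 - c * b)) * t by rewrite dE mul1r.
have -> : d * (1 - c * b) * t = d * (t - c * b * t) by ring.
exact: idealM.
Qed.

(** Surjectivity of Hom(A/I, E) -> Hom(A/I, Z) for Z the image of d, that is
    vanishing of Ext^1(A/I, ker d). For the residue field the lift exists
    because A s embeds it into A: a map from it into Z extends to A, hence
    lifts to E, hence restricts. The general A/I is reached by induction on its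
    length, splitting off a simple submodule (t + I)/I. *)
Lemma lift_annihilated (E E' : lmodType A) (d : {linear E -> E'}) :
  extension_property (@setT E) -> extension_property (range d) ->
  forall (I : set A) (x : E), ideal I -> (forall a, I a -> a *: d x = 0) ->
    exists2 e, d e = d x & forall a, I a -> a *: e = 0.
Proof.
move=> XE XZ; have [mu hmu] := flA.
move=> I; have [n] := ubnP (mu I); elim: n I => // n IHn I In x hI Ix.
have [I1|nI1] := pselect (I 1).
  have dx : d x = 0 by rewrite -[d x]scale1r; apply: Ix.
  by exists 0; rewrite ?raddf0 // => a _; rewrite scaler0.
have [t It tsoc] := ex_socle_mod hI nI1.
(* t *: d x lies in the socle of Z; the extension property of Z along A s
   divides it by s. *)
have [|||_ [[z _ <-] _ zE]] := XZ (@zero_ideal A) s (t *: d x).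
- exact: zero_ideal_ideal.
- by exists (t *: x); rewrite ?linearZ.
- move=> a as0; rewrite scalerA; exact: Ix (tsoc _ as0).
(* s *: z is thus a lift of t *: d x killed by the maximal ideal, and e0 carries
   it from (t + I)/I to A/I; subtracting e0 enlarges I to I + A t. *)
have [|a|e0 [_ Ie0 te0]] := XE I t (s *: z) hI.
- by [].
- move=> Iat; have [as0|[c ca]] := unit_or_kill a.
    by rewrite scalerA as0 scale0r.
  case: It; have -> : t = c * (a * t) by rewrite mulrA ca mul1r.
  exact: idealM.
have [|||e1 de1 Je1] := IHn (adjoin I t) _ (x - e0).
- rewrite -ltnS (leq_trans _ In) // ltnS; apply: hmu => //.
    exact: adjoin_ideal.
    by move=> a; apply: sub_adjoin.
  by exists t => //; apply: mem_adjoin.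
- exact: adjoin_ideal.
- move=> a [c Ic]; rewrite raddfB scalerBr -!linearZ /=.
  have aE (F : lmodType A) (v : F) : a *: v = (a - c * t) *: v + c *: (t *: v).
    by rewrite scalerA -scalerDl subrK.
  rewrite [a *: x]aE [a *: e0]aE Ie0 // add0r te0 raddfD /= !linearZ /= Ix //.
  by rewrite add0r scalerN zE scalerN subrr.
exists (e0 + e1); first by rewrite raddfD /= de1 raddfB /= addrC subrK.
move=> a Ia; rewrite scalerDr Ie0 // Je1 ?addr0 //.
exact: sub_adjoin.
Qed.

(** Extend the map with values in E instead of ker d. The image d e of its value
    e at 1 is killed by I + A t, so e can be corrected by another lift of d e
    that is itself killed by I + A t. *)
Lemma kernel_extension_property (E E' : lmodType A) (d : {linear E -> E'}) :
  extension_property (@setT E) -> extension_property (range d) ->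
  extension_property (fun x => d x = 0).
Proof.
move=> XE XZ I t y hI dy hy.
have [//|e [_ Ie te]] := XE I t y hI _ hy.
have [|e' de' Je'] := lift_annihilated XE XZ (adjoin_ideal t hI) (x := e).
  move=> a [c Ic]; have -> : a = (a - c * t) + c * t by rewrite subrK.
  rewrite scalerDl -scalerA -[t *: d e]linearZ te dy -linearZ Ie //.
  by rewrite raddf0 scaler0 addr0.
exists (e - e'); split.
- by rewrite raddfB /= de' subrr.
- by move=> a Ia; rewrite scalerBr Ie // Je' ?subrr //; apply: sub_adjoin.
- by rewrite scalerBr te Je' ?subr0 //; apply: mem_adjoin.
Qed.

(** Going down a finite injective resolution of A, all kernels, and finally A
    itself, inherit the extension property. Applied to A s with the map
    s |-> s' it gives s' as a multiple of s: the socle of A is simple. *)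
Lemma finite_injective_dimension_socle :
  finite_injective_dimension A^o ->
  forall s', (forall b, b * s = 0 -> b * s' = 0) -> exists c, s' = c * s.
Proof.
move=> [E [eta [d [[injE eta_inj exact0 exactS] [N EN]]]]] s' hs'.
have XE n : extension_property (@setT (E n)).
  exact: injective_extension_property.
have range_ker n : range (d n) = [set x | d n.+1 x = 0]%classic.
  apply/seteqP; split=> x /=; last by move/exactS => [y <-]; exists y.
  by move=> [y _ <-]; apply/exactS; exists y.
have XZ m n : (N < n + m)%N -> extension_property (fun x => d n x = 0).
  elim: m n => [|m IHm] n; last first.
    rewrite addnS -addSn => /IHm XS; apply: kernel_extension_property => //.
    by rewrite range_ker.
  rewrite addn0 => Nn I t y hI dy hy; exists 0; split.
  - by rewrite raddf0.
  - by move=> a _; rewrite scaler0.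
  - by rewrite scaler0 (EN _ Nn y).
have [||||e [de _ se]] := XZ N.+1 0%N _ (@zero_ideal A) s (eta s').
- exact: leqnn.
- exact: zero_ideal_ideal.
- by apply/exact0; exists s'.
- by move=> a /hs' as'; rewrite -linearZ /= [_ *: _]as' raddf0.
move/exact0: de se => [y <-]; rewrite -linearZ => /eta_inj yE.
by exists y; rewrite mulrC -yE.
Qed.

End ExtensionProperty.

(** * Localization at a prime ideal *)

Section LocalRingAtPrime.

Variables (R : comPzRingType) (q : prime_ideal R).
Local Notation frac a := (to_loc_at q a).

Lemma loc_at_eq a b : frac a = frac b <->
  exists2 u, ~ prime_set q u & u * a = u * b.
Proof.
split=> [/loc_mk_eq[u /asboolP uq]|[u uq ab]].
  by rewrite !mulr1; exists u.
by apply/loc_mk_eq; exists u; [apply/asboolP|rewrite !mulr1].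
Qed.

Lemma loc_at_eq0 a : frac a = 0 <-> exists2 u, ~ prime_set q u & u * a = 0.
Proof.
rewrite -(rmorph0 (to_loc_at q)); split=> [/loc_at_eq[u uq e]|[u uq e]].
  by exists u => //; rewrite e mulr0.
by apply/loc_at_eq; exists u; rewrite // e mulr0.
Qed.

Lemma loc_at_fraction (z : loc_at q) :
  exists a u, ~ prime_set q u /\ z * frac u = frac a.
Proof.
have [a [[u uS] ->]] := loc_mkP z; exists a, u; split; first exact/asboolP.
rewrite -[LHS]/(loc_mul _ _) loc_mulE; apply: loc_mk_eq1 => /=; ring.
Qed.

Lemma loc_at_unit u : ~ prime_set q u -> exists z, z * frac u = 1.
Proof.
move=> uq; have uS : u \in @prime_compl _ q by apply/asboolP.
exists (loc_mk 1 (exist _ u uS)).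
rewrite -[LHS]/(loc_mul _ _) loc_mulE; apply: loc_mk_eq1 => /=; ring.
Qed.

Lemma loc_at_proper u : prime_set q u -> ~ exists z, z * frac u = 1.
Proof.
move=> qu [z zu]; have [a [v [vq zv]]] := loc_at_fraction z.
have /loc_at_eq[w wq] : frac (a * u) = frac v.
  by rewrite rmorphM /= -zv -mulrA [X in _ * X]mulrC mulrA zu mul1r.
move=> e; have : prime_set q (w * v).
  rewrite -e !mulrA; apply: idealM => //; exact: prime_ideal_ideal.
by case/prime_ideal_mul.
Qed.

Definition contraction (I : set (loc_at q)) : set R := fun a => I (frac a).

Lemma contraction_ideal I : ideal I -> ideal (contraction I).
Proof.
move=> hI; split; rewrite /contraction.
- by rewrite rmorph0; apply: ideal0.
- by move=> x y Ix Iy; rewrite rmorphD; apply: idealD.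
- by move=> a x Ix; rewrite rmorphM; apply: idealM.
Qed.

(** An ideal of the localization is determined by its contraction. *)
Lemma loc_at_mem (I : set (loc_at q)) (z : loc_at q) a u : ideal I ->
  ~ prime_set q u -> z * frac u = frac a -> I z <-> I (frac a).
Proof.
move=> hI /loc_at_unit[v vu] za; split=> [Iz|Ia].
  by rewrite -za mulrC; apply: idealM.
have -> : z = v * frac a by rewrite -za mulrCA vu mulr1.
exact: idealM.
Qed.

Lemma finite_length_loc_at : finite_length R -> finite_length (loc_at q).
Proof.
move=> [mu hmu]; exists (fun I => mu (contraction I)) => I J hI hJ IJ [z Jz Iz].
apply: hmu; try exact: contraction_ideal; first by move=> a; apply: IJ.
have [a [u [uq za]]] := loc_at_fraction z.
exists a; first exact/(loc_at_mem hJ uq za).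
by move=> Ia; apply: Iz; apply/(loc_at_mem hI uq za).
Qed.

End LocalRingAtPrime.

Section AnnihilatorPrime.

Variables (R : comPzRingType) (s : R) (hs : simple_elt s).

Definition annihilator : set R := fun a => a * s = 0.

Lemma annihilator_ideal : ideal annihilator.
Proof.
split; rewrite /annihilator; first by rewrite mul0r.
  by move=> x y xs ys; rewrite mulrDl xs ys addr0.
by move=> a x xs; rewrite -mulrA xs mulr0.
Qed.

Lemma annihilator_proper : ~ annihilator 1.
Proof. by rewrite /annihilator mul1r; case: hs. Qed.

Lemma annihilator_prime x y :
  annihilator (x * y) -> annihilator x \/ annihilator y.
Proof.
rewrite /annihilator => xys; have [->|/eqP ys] := eqVneq (y * s) 0.
  by right.
left; have [_ /(_ _ ys)[c <-]] := hs.
have -> : x * (c * y * s) = c * (x * y * s) by ring.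
by rewrite xys mulr0.
Qed.

Definition annihilator_prime_ideal :=
  PrimeIdeal annihilator_ideal annihilator_proper annihilator_prime.

End AnnihilatorPrime.

(** The maximal ideal m = Ann s is prime, and the simple module A s survives in
    the localization at m, whose socle is simple. So s' = c s holds there, and
    because elements outside m act invertibly on s it holds in T. *)
Lemma gorenstein_multiplicity_free_socle (T : comPzRingType) :
  finite_length T -> gorenstein T -> multiplicity_free_socle T.
Proof.
move=> flT [_ gorT] s s' hs hs'.
pose m := annihilator_prime_ideal hs; pose fr := to_loc_at m.
have kill a u : ~ prime_set m u -> u * a * s = 0 -> a * s = 0.
  move=> mu uas; have /annihilator_prime : annihilator s (u * a) by [].
  by case.
have s0 : fr s <> 0.
  by move=> /loc_at_eq0[u mu us]; apply: mu.
have [||c cE] := finite_injective_dimension_socle s0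
    (finite_length_loc_at m flT) _ (gorT m).2 (s' := fr s').
- move=> z; have [a [u [mu za]]] := loc_at_fraction z.
  have [v vu] := loc_at_unit mu.
  have zE : z = v * fr a by rewrite -za mulrCA vu mulr1.
  have [as0|/eqP nas] := eqVneq (a * s) 0.
    by left; rewrite zE -mulrA -rmorphM as0 rmorph0 mulr0.
  have [w wa] := @loc_at_unit _ m a nas.
  by right; exists (w * fr u); rewrite zE [v * _]mulrC mulrACA wa mul1r mulrC.
- move=> z zs; have [a [u [mu za]]] := loc_at_fraction z.
  have [v vu] := loc_at_unit mu.
  have zE : z = v * fr a by rewrite -za mulrCA vu mulr1.
  have : fr (a * s) = 0 by rewrite rmorphM -za mulrAC zs mul0r.
  move=> /loc_at_eq0[w mw was].
  rewrite zE -mulrA -rmorphM hs' ?rmorph0 ?mulr0 //.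
  by apply: kill mw _; rewrite -mulrA.
have [a [u [mu ca]]] := loc_at_fraction c.
have /loc_at_eq[w mw wE] : fr (u * s') = fr (a * s).
  by rewrite !rmorphM cE -ca mulrA [fr u * c]mulrC.
have mwu : ~ prime_set m (w * u) by move=> /annihilator_prime [].
have [d dE] := hs.2 _ mwu.
have dE' : (1 - d * (w * u)) * s' = 0.
  by apply: hs'; rewrite mulrBl mul1r dE subrr.
exists (d * w * a); rewrite -[LHS]subr0 -dE'.
have -> : s' - (1 - d * (w * u)) * s' = d * (w * (u * s')) by ring.
by rewrite wE; ring.
Qed.

(** * Algebras with a finite basis, trace forms and Casimir elements *)

Definition lincomb (F A : comPzRingType) (g : F -> A) n (e : 'I_n -> A)
    (c : 'rV[F]_n) : A :=
  \sum_i g (c 0 i) * e i.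

Record coordinates (F A : comPzRingType) (g : F -> A) (n : nat) := Coordinates {
  basis : 'I_n -> A;
  coord : A -> 'rV[F]_n;
  lincombK : cancel (lincomb g basis) coord;
  coordK : cancel coord (lincomb g basis) }.

Section Coordinates.

Variables (F A : comPzRingType) (g : {rmorphism F -> A}) (n : nat).
Variable X : coordinates g n.
Local Notation e := (basis X).

Lemma lincomb_linear c u v :
  lincomb g e (c *: u + v) = g c * lincomb g e u + lincomb g e v.
Proof.
rewrite /lincomb mulr_sumr -big_split; apply: eq_bigr => i _ /=.
by rewrite !mxE rmorphD rmorphM /= mulrDl mulrA.
Qed.

Lemma coord_linear c x y : coord X (g c * x + y) = c *: coord X x + coord X y.
Proof.
by rewrite -{1}[x](coordK X) -{1}[y](coordK X) -lincomb_linear lincombK.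
Qed.

Lemma coordD x y : coord X (x + y) = coord X x + coord X y.
Proof. by have := coord_linear 1 x y; rewrite rmorph1 mul1r scale1r. Qed.

Lemma coord0 : coord X 0 = 0.
Proof. by apply: (addrI (coord X 0)); rewrite -coordD !addr0. Qed.

Lemma coordZ c x : coord X (g c * x) = c *: coord X x.
Proof. by rewrite -[g c * x]addr0 coord_linear coord0 addr0. Qed.

Lemma coordB x y : coord X (x - y) = coord X x - coord X y.
Proof. by apply: (addIr (coord X y)); rewrite -coordD !subrK. Qed.

Lemma lincomb0 : lincomb g e 0 = 0.
Proof. by rewrite -coord0 coordK. Qed.

Lemma coord_basis i : coord X (e i) = delta_mx 0 i.
Proof.
apply: (can_inj (lincombK X)).
rewrite coordK /lincomb (bigD1 i) //= big1 => [|j].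
  by rewrite mxE !eqxx rmorph1 mul1r addr0.
by rewrite mxE => /negPf ->; rewrite andbF rmorph0 mul0r.
Qed.

Lemma coord_sum (I : finType) (x : I -> A) :
  coord X (\sum_i x i) = \sum_i coord X (x i).
Proof. by apply: (big_morph (coord X)); [exact: coordD|exact: coord0]. Qed.

(** Coordinates are row vectors, and a acts on them from the right by this
    matrix; functionals on A are columns, on which it acts from the left. *)
Definition mulmx_by (a : A) : 'M[F]_n := \matrix_i coord X (a * e i).
Local Notation Mx := mulmx_by.

Lemma row_mulmx_by a i : row i (Mx a) = coord X (a * e i).
Proof. exact: rowK. Qed.

Lemma coordM a x : coord X (a * x) = coord X x *m Mx a.
Proof.
rewrite -{1}[x](coordK X) /lincomb mulr_sumr coord_sum mulmx_sum_row.
apply: eq_bigr => i _; rewrite row_mulmx_by -coordZ; congr coord; ring.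
Qed.

Lemma mulmx_byM a b : Mx (a * b) = Mx a *m Mx b.
Proof.
apply/row_matrixP => i; rewrite row_mul !row_mulmx_by -coordM.
by congr coord; ring.
Qed.

Lemma mulmx_by_linear c a b : Mx (g c * a + b) = c *: Mx a + Mx b.
Proof.
apply/row_matrixP => i; rewrite linearP /= !row_mulmx_by -coord_linear.
by rewrite mulrDl mulrA.
Qed.

Lemma mulmx_by1 : Mx 1 = 1%:M.
Proof.
by apply/row_matrixP => i; rewrite row_mulmx_by mul1r coord_basis row1.
Qed.

Lemma mulmx_byD a b : Mx (a + b) = Mx a + Mx b.
Proof. by have := mulmx_by_linear 1 a b; rewrite rmorph1 mul1r scale1r. Qed.

Lemma mulmx_by0 : Mx 0 = 0.
Proof. by apply: (addrI (Mx 0)); rewrite -mulmx_byD !addr0. Qed.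

Lemma mulmx_byZ c a : Mx (g c * a) = c *: Mx a.
Proof. by rewrite -[g c * a]addr0 mulmx_by_linear mulmx_by0 addr0. Qed.

Lemma mulmx_by_lincomb a : Mx a = \sum_i coord X a 0 i *: Mx (e i).
Proof.
rewrite -{1}[a](coordK X) /lincomb (big_morph _ mulmx_byD mulmx_by0).
by apply: eq_bigr => i _; rewrite mulmx_byZ.
Qed.

(** The Gram matrix of the bilinear form tau(a b), where tau is the functional
    with column t. *)
Definition gram (t : 'cV[F]_n) : 'M[F]_n := \matrix_i (Mx (e i) *m t)^T.

Lemma gramE t i j : gram t i j = (coord X (e i * e j) *m t) 0 0.
Proof. by rewrite !mxE; apply: eq_bigr => l _; rewrite !mxE. Qed.

Lemma tr_gram t : (gram t)^T = gram t.
Proof. by apply/matrixP => i j; rewrite mxE !gramE mulrC. Qed.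

Lemma coord_gram a t : coord X a *m gram t = (Mx a *m t)^T.
Proof.
rewrite mulmx_sum_row [Mx a]mulmx_by_lincomb mulmx_suml linear_sum.
by apply: eq_bigr => i _; rewrite rowK -scalemxAl linearZ.
Qed.

Lemma gram_mul a t : gram (Mx a *m t) = Mx a *m gram t.
Proof.
by apply/row_matrixP => i; rewrite rowK row_mul row_mulmx_by coord_gram mulmxA
  -mulmx_byM [a * _]mulrC.
Qed.

(** B stands for the element of A (x) A with coefficients B_ij on the
    e_i (x) e_j; the condition says that the two actions of A on it agree.
    Contracting the first factor identifies these elements with the
    A-linear maps Hom_F(A, F) -> A. *)
Definition casimir (B : 'M[F]_n) : Prop := forall a, B *m Mx a = (Mx a)^T *m B.

(** When tau generates the dual of A, an A-linear map h from the dual to A is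
    determined by h(tau), and pairing h(a tau) with b tau gives
    tau(a b h(tau)), which is symmetric in a and b. These values are the
    entries of G B G for the Gram matrix G. *)
Lemma casimir_gram_sym t N B :
  gram t *m N = 1%:M -> casimir B -> B^T = B.
Proof.
move=> GN hB; have NG : N^T *m gram t = 1%:M.
  by rewrite -[gram t]tr_gram -trmx_mul GN trmx1.
have col_gram j : col j (gram t) = Mx (e j) *m t.
  by rewrite -[gram t]tr_gram -tr_row rowK trmxK.
have entry i j :
    (gram t *m B *m gram t) i j = (t^T *m B *m Mx (e i * e j) *m t) 0 0.
  transitivity (col j (row i (gram t *m B *m gram t)) 0 0).
    by rewrite !mxE.
  rewrite !row_mul colE -mulmxA -colE col_gram rowK trmx_mul.
  rewrite -[t^T *m _ *m B]mulmxA -hB.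
  by rewrite mulmx_byM !mulmxA.
have sym : (gram t *m B *m gram t)^T = gram t *m B *m gram t.
  by apply/matrixP => i j; rewrite mxE !entry mulrC.
rewrite !trmx_mul tr_gram mulmxA in sym.
have := congr1 (fun M => N^T *m M *m N) sym.
by rewrite -!mulmxA GN !mulmx1 !mulmxA NG !mul1mx.
Qed.

End Coordinates.

(** * Finite-dimensional algebras over a field *)

Section OverField.

Variables (k : fieldType) (A : comPzRingType) (g : {rmorphism k -> A}).
Variable n : nat.
Variable X : coordinates g n.
Local Notation e := (basis X).
Local Notation Mx := (mulmx_by X).
Local Notation lc := (lincomb g e).

Definition spanned_in (I : set A) (W : 'M[k]_n) : Prop :=
  forall v : 'rV_n, (v <= W)%MS -> I (lc v).

Lemma ex_spanning I : ideal I ->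
  exists2 W, spanned_in I W & forall x, I x -> (coord X x <= W)%MS.
Proof.
move=> hI.
have [||W hW Wmax] := @ex_maximal 'M[k]_n (spanned_in I) (fun W => \rank W) n.
- exists 0 => v; rewrite submx0 => /eqP ->; rewrite lincomb0; exact: ideal0.
- by move=> W _; apply: rank_leq_row.
exists W => // x Ix.
have /Wmax leW : spanned_in I (W + coord X x)%MS.
  move=> v /sub_addsmxP[[u c] /= ->].
  have lcD u1 u2 : lc (u1 + u2) = lc u1 + lc u2.
    by have := lincomb_linear X 1 u1 u2; rewrite rmorph1 mul1r scale1r.
  rewrite lcD; apply: idealD => //; first by apply: hW; apply: submxMl.
  rewrite [c]mx11_scalar mul_scalar_mx -coordZ coordK; exact: idealM.
have /mxrank_leqif_sup/geq_leqif : (W <= W + coord X x)%MS by apply: addsmxSl.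
by rewrite leW => /esym; apply: submx_trans; apply: addsmxSr.
Qed.

(** The codimension over k is a length function. *)
Lemma finite_length_coordinates : finite_length A.
Proof.
pose W (I : set A) := if pselect (ideal I) is left hI
  then projT1 (cid2 (ex_spanning hI)) else 0.
have WP I : ideal I ->
    spanned_in I (W I) /\ forall x, I x -> (coord X x <= W I)%MS.
  by rewrite /W; case: pselect => // hI _; case: cid2.
exists (fun I => n - \rank (W I))%N => I J hI hJ IJ [x Jx nIx].
have [sI inI] := WP _ hI; have [sJ inJ] := WP _ hJ.
have /rank_ltmx IW : (W I < W J)%MS.
  rewrite ltmxE; apply/andP; split.
    apply/row_subP => i; rewrite -[row i _](lincombK X); apply: inJ; apply: IJ.
    by apply: sI; apply: row_sub.
  apply/negP => JI; apply: nIx; rewrite -(coordK X x); apply: sI.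
  by apply: submx_trans JI; apply: inJ.
by apply: ltn_sub2l => //; apply: leq_trans IW (rank_leq_row _).
Qed.

Lemma noetherian_coordinates : noetherian A.
Proof.
move=> I hI; have [W sW inW] := ex_spanning hI.
exists n, (fun i => lc (row i W)) => x; split=> [/inW/submxP[u xE]|[c ->]].
  exists (fun i => g (u 0 i)); rewrite -[LHS](coordK X) xE mulmx_sum_row.
  apply: (can_inj (coordK X)); rewrite lincombK coord_sum.
  by apply: eq_bigr => i _; rewrite coordZ lincombK.
by apply: ideal_sum => // i; apply: idealM => //; apply: sW; apply: row_sub.
Qed.

(** Eigenvectors for distinct eigenvalues: the annihilators are distinct maximal
    ideals, and a product of elements of all but one of them, taken outside the
    remaining one, isolates a single term of a linear relation. *)
Lemma row_free_simple r (s : 'I_r -> A) : (forall i, simple_elt (s i)) ->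
  (forall i j, i != j -> exists2 a, a * s i = 0 & a * s j <> 0) ->
  row_free (\matrix_i coord X (s i)).
Proof.
move=> simp sep; apply: inj_row_free => y; rewrite mulmx_sum_row => y0.
have {y0} : \sum_i g (y 0 i) * s i = 0.
  apply: (can_inj (coordK X)); rewrite coord0 coord_sum -[RHS]y0.
  by apply: eq_bigr => i _; rewrite coordZ rowK.
move=> y0; apply/rowP => j; rewrite mxE; apply: contrapT => /eqP yj.
have [a aP] : exists a, (forall i, i != j -> a * s i = 0) /\ a * s j <> 0.
  have : forall (l : seq 'I_r), exists a,
      (forall i, i \in l -> i != j -> a * s i = 0) /\ a * s j <> 0.
    elim=> [|i l [a [al aj]]].
      by exists 1; rewrite mul1r; split=> //; case: (simp j).
    have [->|ij] := eqVneq i j.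
      exists a; split=> // i'; rewrite inE => /orP[/eqP -> /eqP //|]; exact: al.
    have [b bi bj] := sep _ _ ij.
    exists (b * a); split.
      move=> i'; rewrite inE => /orP[/eqP -> _|i'l i'j].
        by rewrite mulrAC bi mul0r.
      by rewrite -mulrA al // mulr0.
    by move=> /(annihilator_prime (simp j)) [].
  move=> /(_ (enum 'I_r)) [a [a1 a2]]; exists a; split=> // i.
  by apply: a1; rewrite mem_enum.
case: aP => ai aj; apply: aj.
have : a * \sum_i g (y 0 i) * s i = 0 by rewrite y0 mulr0.
rewrite (bigD1 j) //= mulrDr mulr_sumr big1 => [|i ij]; last first.
  by rewrite mulrCA ai // mulr0.
rewrite addr0 => e0; have : g (y 0 j)^-1 * (a * (g (y 0 j) * s j)) = 0.
  by rewrite e0 mulr0.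
have -> : g (y 0 j)^-1 * (a * (g (y 0 j) * s j)) =
   (g (y 0 j)^-1 * g (y 0 j)) * (a * s j) by ring.
by rewrite -rmorphM /= mulVf // rmorph1 mul1r.
Qed.

(** A functional is nondegenerate as soon as it is nonzero on every simple
    ideal, since each nonzero ideal contains one. Choose a largest family of
    simple elements with pairwise different annihilators; they are linearly
    independent, so some functional takes the value 1 on all of them, and a
    multiplicity-free socle has no other simple ideals than the ones they
    generate. *)
Lemma ex_nondegenerate_form : multiplicity_free_socle A ->
  exists t, gram X t \in unitmx.
Proof.
move=> socA.
pose sep r (s : 'I_r -> A) := (forall i, simple_elt (s i)) /\
  (forall i j, i != j -> exists2 a, a * s i = 0 & a * s j <> 0).
have [||[r s] /= [simp sepS] rmax] := @ex_maximal {r & 'I_r -> A}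
    (fun s => sep _ (projT2 s)) (fun s => projT1 s) n.
- by exists (existT _ 0%N (fun _ => 0)); split=> -[].
- move=> [r s] /= [simp sepS]; have := row_free_simple simp sepS.
  by rewrite /row_free => /eqP <-; apply: rank_leq_col.
pose W := \matrix_i coord X (s i).
have Wfree : row_free W by apply: row_free_simple.
pose t : 'cV_n := pinvmx W *m const_mx 1.
have st i : (coord X (s i) *m t) 0 0 = 1.
  have -> : coord X (s i) = row i W by rewrite rowK.
  by rewrite -row_mul mulmxA mulmxVp // mul1mx !mxE.
have key u : simple_elt u -> exists a i, a * u = s i.
  move=> hu.
  have [i [a]] : exists i a, s i = a * u \/ u = a * s i.
    apply: contrapT => noi.
    have sepu i : (exists2 a, a * s i = 0 & a * u <> 0) /\
                  (exists2 a, a * u = 0 & a * s i <> 0).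
      split; apply: contrapT => /forall2NP ha; apply: noi; exists i.
        have [|a ->] := socA (s i) u (simp i); last by exists a; right.
        by move=> a as0; have [|/contrapT] := ha a.
      have [|a ->] := socA u (s i) hu; last by exists a; left.
      by move=> a as0; have [|/contrapT] := ha a.
    pose s' (i : 'I_r.+1) := if unlift ord0 i is Some j then s j else u.
    have := rmax (existT _ r.+1 s') _; rewrite /= ltnn.
    move=> h; suff : false by []; apply: h; split.
      by move=> i; rewrite /s'; case: unliftP.
    move=> i j; rewrite /s'.
    case: unliftP => [i' ->|->]; case: unliftP => [j' ->|->].
    - by rewrite (inj_eq lift_inj) => /sepS.
    - by move=> _; case: (sepu i').
    - by move=> _; case: (sepu j').
    - by move/eqP.
  case=> [sE|uE]; first by exists a, i.
  have asi : a * s i <> 0 by rewrite -uE; case: hu.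
  have [c cE] := (simp i).2 _ asi.
  by exists c, i; rewrite uE mulrA.
exists t; rewrite -row_free_unit; apply: inj_row_free => v vt0.
rewrite -[v](lincombK X); have [->|/eqP v0] := eqVneq (lc v) 0.
  exact: coord0.
have [b /key[a [i si]]] := ex_simple_multiple finite_length_coordinates v0.
have : (Mx (lc v) *m t) = 0.
  by apply: trmx_inj; rewrite -coord_gram lincombK vt0 trmx0.
have := st i; rewrite -si mulrA mulrC coordM -mulmxA => + e.
by rewrite e mulmx0 mxE => /esym/eqP; rewrite oner_eq0.
Qed.

(** If A s and A s' are isomorphic simple ideals, every functional phi
    restricts on A s to c tau0 for some c in A, where tau0 is a fixed functional
    with tau0(s) nonzero, and phi |-> c s' is A-linear from the dual to A. The
    corresponding Casimir element lies in A s (x) A s'. If it is symmetric, a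
    functional that vanishes on A s' must vanish on A s, so that s lies in
    A s'. *)
Lemma multiplicity_free_socle_of_casimir_sym :
  (forall B, casimir X B -> B^T = B) -> multiplicity_free_socle A.
Proof.
move=> sym s s' hs hs'.
have s_row : coord X s != 0.
  apply/eqP => s0; apply: hs.1; apply: (can_inj (coordK X)).
  by rewrite s0 coord0.
have /rV0Pn[i0 si0] := s_row.
pose t0 : 'cV[k]_n := delta_mx i0 0.
have t0s : (coord X s *m t0) 0 0 != 0 by rewrite -colE mxE.
(* M is the form tau0(a b s), whose radical is Ann s. *)
pose M := gram X (Mx s *m t0).
have MT : M^T = M by exact: tr_gram.
have kerM a : coord X a *m M = 0 -> a * s = 0.
  rewrite coord_gram mulmxA -mulmx_byM => /(congr1 trmx); rewrite trmxK trmx0.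
  move=> e; apply: contrapT => /(hs.2 a)[c cE].
  case/eqP: t0s; rewrite -cE -mulrA [c * _]mulrC coordM -mulmxA.
  by rewrite e mulmx0 mxE.
have kerM_by r (Y : 'M_(r, n)) u : (forall a, a * s = 0 -> a * u = 0) ->
    Y *m M = 0 -> Y *m Mx u = 0.
  move=> hu YM; apply/row_matrixP => i; rewrite row_mul row0.
  rewrite -[row i Y](lincombK X) -coordM mulrC hu ?coord0 //.
  by apply: kerM; rewrite lincombK -row_mul YM row0.
have sM : ((Mx s)^T <= M)%MS.
  rewrite submxE -[_ *m _]trmxK trmx_mul trmxK.
  rewrite (kerM_by _ _ s) ?trmx0 //.
  by rewrite -{2}MT -trmx_mul mulmx_coker trmx0.
(* Z sends phi to the coordinates of c. *)
have [Z ZM] : exists Z, Z *m M = (Mx s)^T.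
  by have /submxP[Z ->] := sM; exists Z.
have MxM a : M *m (Mx a)^T = Mx a *m M.
  by rewrite -{1}MT -trmx_mul -gram_mul tr_gram.
have cas : casimir X (Z *m Mx s').
  move=> a; apply/eqP; rewrite -subr_eq0; apply/eqP.
  rewrite -mulmxA -mulmx_byM [s' * a]mulrC mulmx_byM !mulmxA -mulmxBl.
  apply: kerM_by hs' _; rewrite mulmxBl -!mulmxA ZM -MxM mulmxA ZM.
  by rewrite -!trmx_mul -!mulmx_byM mulrC subrr.
have ZT := sym _ cas.
have from_sub c' : s = c' * s' -> exists c, s' = c * s.
  move=> sE; have c's : c' * s <> 0.
    by move=> /hs'; rewrite -sE; case: hs.
  have [c cE] := hs.2 _ c's.
  exists c; rewrite -[LHS]subr0 [in RHS]sE.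
  have /hs' <- : (1 - c * c') * s = 0 by rewrite mulrBl mul1r cE subrr.
  ring.
(* A functional vanishing on A s' but not on A s exists unless A s is contained
   in A s'. *)
have [sub|nsub] := boolP (Mx s <= Mx s')%MS.
  have /submxP[u uE] : (coord X s <= Mx s')%MS.
    by rewrite -[s]mulr1 coordM; apply: submx_trans sub; apply: submxMl.
  apply: (from_sub (lc u)); apply: (can_inj (coordK X)).
  by rewrite mulrC coordM lincombK.
have [j /eqP phi1] : exists j, Mx s *m col j (cokermx (Mx s')) != 0.
  apply: contrapT => h; case/negP: nsub; rewrite submxE; apply/eqP.
  apply/matrixP => i j; have : Mx s *m col j (cokermx (Mx s')) = 0.
    by apply: contrapT => /eqP hj; apply: h; exists j.
  by rewrite colE mulmxA -colE => /colP/(_ i); rewrite !mxE.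
pose phi := col j (cokermx (Mx s')).
have phi0 : Mx s' *m phi = 0 by rewrite /phi colE mulmxA mulmx_coker mul0mx.
pose c := lc (phi^T *m Z).
have cs' : c * s' = 0.
  apply: (can_inj (coordK X)); rewrite mulrC coordM lincombK coord0.
  by rewrite -mulmxA -ZT -trmx_mul -mulmxA phi0 mulmx0 trmx0.
have cs : c * s <> 0.
  move=> cs0; apply: phi1; apply: trmx_inj.
  rewrite trmx0 trmx_mul -/phi -ZM mulmxA.
  rewrite -[phi^T *m Z](lincombK X) -/c coord_gram mulmxA -mulmx_byM cs0.
  by rewrite mulmx_by0 mul0mx trmx0.
have [d dE] := hs.2 _ cs; exists 0; rewrite mul0r.
have /hs' : (1 - d * c) * s = 0 by rewrite mulrBl mul1r dE subrr.
by rewrite mulrBl mul1r -mulrA cs' mulr0 subr0.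
Qed.

End OverField.

(** * First extensions by a twisted action *)

(** A 1-cocycle of the bar complex of M with values in N: exactly what is
    needed for a (r, x) = (a r + v(a, x), a x) to define a module structure
    on N x M. *)
Record cocycle (R : comPzRingType) (M N : lmodType R) := Cocycle {
  cocycle_fun :> R -> M -> N;
  cocycleDl : forall a b x,
    cocycle_fun (a + b) x = cocycle_fun a x + cocycle_fun b x;
  cocycleDr : forall a x y,
    cocycle_fun a (x + y) = cocycle_fun a x + cocycle_fun a y;
  cocycleM : forall a b x,
    cocycle_fun (a * b) x = a *: cocycle_fun b x + cocycle_fun a (b *: x) }.

Section TwistedModule.

Variables (R : comPzRingType) (M N : lmodType R) (v : cocycle M N).

Lemma cocycle1 x : v 1 x = 0.
Proof.
apply: (addrI (v 1 x)); rewrite addr0.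
by have := cocycleM v 1 1 x; rewrite mulr1 !scale1r => <-.
Qed.

Lemma cocycle0r a : v a 0 = 0.
Proof. by apply: (addrI (v a 0)); rewrite -cocycleDr !addr0. Qed.

Definition twisted of cocycle M N : Type := (N * M)%type.
Local Notation E := (twisted v).

HB.instance Definition _ := GRing.Zmodule.on E.

Definition twisted_scale (a : R) (z : E) : E :=
  (a *: z.1 + v a z.2, a *: z.2).

Lemma twisted_scaleA a b z :
  twisted_scale a (twisted_scale b z) = twisted_scale (a * b) z.
Proof.
case: z => r x; rewrite /twisted_scale /= cocycleM !scalerDr !scalerA.
by rewrite addrA.
Qed.

Lemma twisted_scale1 : left_id 1 twisted_scale.
Proof. by case=> r x; rewrite /twisted_scale /= cocycle1 !scale1r addr0. Qed.

Lemma twisted_scaleDr : right_distributive twisted_scale +%R.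
Proof.
move=> a [r x] [r' x']; rewrite /twisted_scale /=; congr (_, _) => /=.
  by rewrite cocycleDr scalerDr addrACA.
by rewrite scalerDr.
Qed.

Lemma twisted_scaleDl z : {morph twisted_scale^~ z : a b / a + b}.
Proof.
case: z => r x a b; rewrite /twisted_scale /=; congr (_, _) => /=.
  by rewrite cocycleDl scalerDl addrACA.
by rewrite scalerDl.
Qed.

HB.instance Definition _ := GRing.Zmodule_isLmodule.Build R E
  twisted_scaleA twisted_scale1 twisted_scaleDr twisted_scaleDl.

Definition twisted_proj (z : E) : M := z.2.

Lemma twisted_proj_linear : linear twisted_proj.
Proof. by []. Qed.

HB.instance Definition _ :=
  GRing.isLinear.Build R E M _ twisted_proj twisted_proj_linear.

(** Lift the augmentation F_0 -> M to the twisted extension. Its N-component s1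
    fails to be linear only by v, so it restricts to a cocycle F_1 -> N, which
    by hypothesis is the restriction of a linear g on F_0; then g - s1 factors
    through M and splits the extension additively. *)
Lemma Ext1_vanishes_coboundary : Ext_vanishes 1 M N ->
  exists u : M -> N, (forall x y, u (x + y) = u x + u y) /\
    forall a x, v a x = a *: u x - u (a *: x).
Proof.
move=> [F [eps [d [[projF eps_surj exact0 exactS] Ext0]]]].
pose pr : {linear E -> M} := twisted_proj.
have [|sigma sigmaE] := projF 0 E M pr eps; first by move=> x; exists (0, x).
pose s1 (z : F 0) : N := (sigma z).1.
have s1D x y : s1 (x + y) = s1 x + s1 y by rewrite /s1 raddfD.
have s1Z a x : s1 (a *: x) = a *: s1 x + v a (eps x).
  by rewrite /s1 linearZ /= -sigmaE.
have eps_d x : eps (d 0 x) = 0 by apply/exact0; exists x.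
have h_linear : linear (fun x => s1 (d 0 x)).
  by move=> a x y; rewrite linearP /= s1D s1Z eps_d cocycle0r addr0.
pose h : {linear F 1 -> N} := HB.pack (fun x => s1 (d 0 x))
  (GRing.isLinear.Build R (F 1) N _ (fun x => s1 (d 0 x)) h_linear).
have [|g gE] := Ext0 h.
  move=> x; rewrite /h /=; have -> : d 0 (d 1 x) = 0 by apply/exactS; exists x.
  by rewrite /s1 raddf0.
pose w z := g z - s1 z.
have wD x y : w (x + y) = w x + w y by rewrite /w raddfD s1D opprD addrACA.
have w0 x : eps x = 0 -> w x = 0.
  by move=> /exact0[y <-]; rewrite /w -gE subrr.
have w_eq x y : eps x = eps y -> w x = w y.
  move=> xy; rewrite -[x](subrK y) wD w0 ?add0r //.
  by rewrite raddfB /= xy subrr.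
pose lift y := projT1 (cid (eps_surj y)).
have liftK y : eps (lift y) = y := projT2 (cid (eps_surj y)).
exists (fun x => w (lift x)); split.
  by move=> x y; rewrite -wD; apply: w_eq; rewrite raddfD /= !liftK.
move=> a x; rewrite (w_eq (lift (a *: x)) (a *: lift x)); last first.
  by rewrite linearZ /= !liftK.
rewrite /w linearZ s1Z /= liftK scalerBr opprB [RHS]addrC addrA subrK.
by rewrite addrAC subrr add0r.
Qed.

End TwistedModule.

(** * Lifting kernels from the residue field *)

Section LiftingFromResidueField.

Variables (P : comPzRingType) (k : fieldType) (pi : {rmorphism P -> k}).
Hypothesis pi_surj : forall y, exists x, pi x = y.
Hypothesis pi_local : forall x, pi x != 0 -> exists y, y * x = 1.

Lemma invertible_of_residue n (M : 'M[P]_n) : map_mx pi M \in unitmx ->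
  exists2 M', M *m M' = 1%:M & M' *m M = 1%:M.
Proof.
rewrite unitmxE det_map_mx unitfE => /pi_local[d dE].
exists (d *: \adj M).
  by rewrite -scalemxAr mul_mx_adj scale_scalar_mx dE.
by rewrite -scalemxAl mul_adj_mx scale_scalar_mx dE.
Qed.

Lemma lift_matrix m n (M : 'M[k]_(m, n)) : exists M', map_mx pi M' = M.
Proof.
exists (\matrix_(i, j) projT1 (cid (pi_surj (M i j)))).
by apply/matrixP => i j; rewrite !mxE; case: cid.
Qed.

(** For a complex P^a -> P^b -> P^c that is exact in the middle over the residue
    field, the kernel of the first map commutes with reduction. Over k split
    the middle term as im A plus a complement cut out by C on which B is
    injective. Lifting X, D and C gives X A + D C invertible by
    the determinant, and C B still has a right inverse. Hence a vector of
    im A has no component along C, and subtracting y X from any lift of x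
    moves it into the kernel of A without changing its reduction. *)
Lemma lift_kernel a b c (A : 'M[P]_(a, b)) (B : 'M[P]_(b, c)) :
  A *m B = 0 ->
  (forall y : 'rV_b, y *m map_mx pi B = 0 -> (y <= map_mx pi A)%MS) ->
  forall x : 'rV_a, x *m map_mx pi A = 0 ->
    exists2 x', map_mx pi x' = x & x' *m A = 0.
Proof.
move=> AB exB x xA; pose Ab := map_mx pi A; pose Bb := map_mx pi B.
have [Cb CBb] : exists Cb, row_base Bb = Cb *m Bb.
  by apply/submxP; rewrite eq_row_base.
have [Db BD] : exists Db, Bb = Db *m row_base Bb.
  by apply/submxP; rewrite eq_row_base.
have [Xb XA] : exists Xb, 1%:M - Db *m Cb = Xb *m Ab.
  apply/submxP/row_subP => i; apply: exB; rewrite -row_mul mulmxBl mul1mx.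
  by rewrite -mulmxA -CBb -BD subrr row0.
have [C CE] := lift_matrix Cb; have [D DE] := lift_matrix Db.
have [X XE] := lift_matrix Xb.
have [L LE] := lift_matrix (pinvmx (row_base Bb)).
have [|T _ TE] := @invertible_of_residue _ (X *m A + D *m C).
  rewrite map_mxD !map_mxM XE DE CE -/Ab -XA subrK; exact: unitmx1.
have [|S SE _] := @invertible_of_residue _ (C *m B *m L).
  rewrite !map_mxM CE LE -/Bb -CBb mulmxVp ?row_base_free //; exact: unitmx1.
have [z zE] := lift_matrix x.
pose y := z *m A *m T.
have yE : z *m A = y *m X *m A + y *m D *m C.
  by rewrite -(mulmxA y X) -(mulmxA y D) -mulmxDr -[RHS]mulmxA TE mulmx1.
have yD : y *m D = 0.
  have : (y *m D) *m (C *m B *m L) = 0.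
    rewrite !mulmxA; have -> : y *m D *m C = z *m A - y *m X *m A.
      by rewrite yE addrC addKr.
    by rewrite mulmxBl -(mulmxA z) -(mulmxA (y *m X)) AB !mulmx0 subrr mul0mx.
  by move=> /(congr1 (mulmx^~ S)); rewrite /= -mulmxA SE mulmx1 mul0mx.
exists (z - y *m X); last by rewrite mulmxBl yE yD mul0mx addr0 subrr.
by rewrite map_mxB !map_mxM zE xA !mul0mx subr0.
Qed.

End LiftingFromResidueField.

(** * The complex whose kernel is the Casimir elements *)

Section CasimirComplex.

Variables (F : comPzRingType) (n : nat) (M : 'I_n -> 'M[F]_n).

(** The beginning of the bar complex computing Ext over A of the dual of A with
    values in A, written in a basis, where M l is the matrix of multiplication
    by the l-th basis vector. A 1-cochain is a bilinear map from A and the dual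
    of A to A; its row l is the matrix of its value at the l-th basis vector. *)
Definition casimir_d0 (B : 'M[F]_n) : 'M[F]_(n, n * n) :=
  \matrix_l mxvec (B *m M l - (M l)^T *m B).

Definition casimir_d1 (V : 'M[F]_(n, n * n)) : 'M[F]_(n, n * (n * n)) :=
  \matrix_l mxvec (\matrix_m mxvec
    (vec_mx (row m V) *m M l - \sum_r M l m r *: vec_mx (row r V)
     + (M m)^T *m vec_mx (row l V))).

Lemma casimir_d0E B l :
  vec_mx (row l (casimir_d0 B)) = B *m M l - (M l)^T *m B.
Proof. by rewrite rowK mxvecK. Qed.

Lemma casimir_d1E V l m : vec_mx (row m (vec_mx (row l (casimir_d1 V)))) =
  vec_mx (row m V) *m M l - \sum_r M l m r *: vec_mx (row r V)
  + (M m)^T *m vec_mx (row l V).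
Proof. by rewrite rowK mxvecK rowK mxvecK. Qed.

Lemma row_vec_mx_inj a b c (V W : 'M[F]_(a, b * c)) :
  (forall i, vec_mx (row i V) = vec_mx (row i W) :> 'M_(b, c)) -> V = W.
Proof. by move=> h; apply/row_matrixP => i; apply: (can_inj vec_mxK). Qed.

Fact casimir_d0_linear a (u v : 'M[F]_n) :
  casimir_d0 (a *: u + v) = a *: casimir_d0 u + casimir_d0 v.
Proof.
apply: row_vec_mx_inj => l; rewrite !linearP /= !casimir_d0E.
by rewrite scalerBr addrACA -opprD mulmxDl mulmxDr scalemxAl scalemxAr.
Qed.

Fact casimir_d1_linear a (u v : 'M[F]_(n, n * n)) :
  casimir_d1 (a *: u + v) = a *: casimir_d1 u + casimir_d1 v.
Proof.
apply: row_vec_mx_inj => l; apply: row_vec_mx_inj => m.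
rewrite !linearP /= !casimir_d1E !linearP /= mulmxDl.
rewrite !scalerDr [RHS]addrACA; congr (_ + _).
rewrite scalerN addrACA -opprD scalemxAl; congr (_ - _).
rewrite scaler_sumr -big_split; apply: eq_bigr => r _ /=.
by rewrite !linearP.
Qed.

HB.instance Definition _ := GRing.isLinear.Build F _ _ _ casimir_d0
  casimir_d0_linear.
HB.instance Definition _ := GRing.isLinear.Build F _ _ _ casimir_d1
  casimir_d1_linear.

Lemma casimir_d0_eq0 B :
  casimir_d0 B = 0 <-> forall l, B *m M l = (M l)^T *m B.
Proof.
split=> [B0 l|BM].
  by apply/eqP; rewrite -subr_eq0 -casimir_d0E B0 row0 linear0.
by apply: row_vec_mx_inj => l; rewrite casimir_d0E BM subrr row0 linear0.
Qed.

Lemma casimir_d1_eq0 V :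
  casimir_d1 V = 0 <-> forall l m,
    \sum_r M l m r *: vec_mx (row r V) =
    vec_mx (row m V) *m M l + (M m)^T *m vec_mx (row l V).
Proof.
split=> [V0 l m|VM].
  apply/esym/eqP; rewrite -subr_eq0 addrAC -casimir_d1E V0.
  by rewrite row0 linear0 row0 linear0.
apply: row_vec_mx_inj => l; apply: row_vec_mx_inj => m.
by rewrite casimir_d1E VM opprD addrA subrr add0r addNr !(row0, linear0).
Qed.

Lemma casimir_d1_d0 B :
  (forall l m, M m *m M l = M l *m M m) ->
  (forall l m, M l *m M m = \sum_r M l m r *: M r) ->
  casimir_d1 (casimir_d0 B) = 0.
Proof.
move=> MC ME; apply/casimir_d1_eq0 => l m.
have -> : \sum_r M l m r *: vec_mx (row r (casimir_d0 B)) =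
    B *m (M l *m M m) - (M l *m M m)^T *m B.
  rewrite ME mulmx_sumr [_^T]linear_sum mulmx_suml -sumrB.
  apply: eq_bigr => r _ /=.
  by rewrite casimir_d0E scalerBr scalemxAr [_^T in RHS]linearZ scalemxAl.
rewrite !casimir_d0E mulmxBl mulmxBr -[B *m M m *m M l]mulmxA (MC l m) trmx_mul.
by rewrite !mulmxA addrA subrK.
Qed.

End CasimirComplex.

Lemma map_casimir_d0 (F F' : comPzRingType) (pi : {rmorphism F -> F'}) n
    (M : 'I_n -> 'M[F]_n) B :
  map_mx pi (casimir_d0 M B) =
  casimir_d0 (fun l => map_mx pi (M l)) (map_mx pi B).
Proof.
apply: row_vec_mx_inj => l.
rewrite casimir_d0E -map_row -map_vec_mx casimir_d0E.
by rewrite map_mxB !map_mxM map_trmx.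
Qed.

Lemma map_casimir_d1 (F F' : comPzRingType) (pi : {rmorphism F -> F'}) n
    (M : 'I_n -> 'M[F]_n) V :
  map_mx pi (casimir_d1 M V) =
  casimir_d1 (fun l => map_mx pi (M l)) (map_mx pi V).
Proof.
apply: row_vec_mx_inj => l; apply: row_vec_mx_inj => m.
rewrite casimir_d1E -map_row -map_vec_mx -map_row -map_vec_mx casimir_d1E.
rewrite map_mxD map_mxB !map_mxM map_trmx !map_vec_mx !map_row.
congr (_ - _ + _); rewrite [LHS](raddf_sum (map_mx pi)).
by apply: eq_bigr => r _ /=; rewrite map_mxZ map_vec_mx map_row mxE.
Qed.

Lemma lift_casimir (P : comPzRingType) (k : fieldType) (pi : {rmorphism P -> k})
    n (M : 'I_n -> 'M[P]_n) :
  (forall y, exists x, pi x = y) ->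
  (forall x, pi x != 0 -> exists y, y * x = 1) ->
  (forall l m, M m *m M l = M l *m M m) ->
  (forall l m, M l *m M m = \sum_r M l m r *: M r) ->
  (forall V, casimir_d1 (fun l => map_mx pi (M l)) V = 0 ->
    exists B, V = casimir_d0 (fun l => map_mx pi (M l)) B) ->
  forall B, casimir_d0 (fun l => map_mx pi (M l)) B = 0 ->
    exists2 B', map_mx pi B' = B & casimir_d0 M B' = 0.
Proof.
move=> pi_surj pi_local MC ME exact1 B B0.
have d0E := map_lin_mx (map_casimir_d0 pi M).
have d1E := map_lin_mx (map_casimir_d1 pi M).
have [|y||x xE x0] := lift_kernel pi_surj pi_local (A := lin_mx (casimir_d0 M))
    (B := lin_mx (casimir_d1 M)) _ _ (x := mxvec B).
- apply/row_matrixP => i; rewrite row_mul row0 rowE mul_rV_lin mx_rV_lin.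
  by rewrite /= casimir_d1_d0 // linear0.
- rewrite d1E d0E mul_rV_lin -[RHS](linear0 mxvec) => /(can_inj mxvecK)/exact1.
  move=> [C yE]; apply/submxP; exists (mxvec C).
  by rewrite mul_vec_lin /= -yE vec_mxK.
- by rewrite d0E mul_vec_lin /= B0 linear0.
exists (vec_mx x); first by rewrite map_vec_mx xE mxvecK.
by apply: (can_inj mxvecK); rewrite linear0 -[RHS]x0 mul_rV_lin.
Qed.

Section CasimirExact.

Variables (F A : comPzRingType) (g : {rmorphism F -> A}) (n : nat).
Variable X : coordinates g n.
Local Notation e := (basis X).
Local Notation Mx := (mulmx_by X).
Local Notation lc := (lincomb g e).
Local Notation M := (fun l => Mx (e l)).

Lemma mulmx_by_basisC l m : Mx (e m) *m Mx (e l) = Mx (e l) *m Mx (e m).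
Proof. by rewrite -!mulmx_byM mulrC. Qed.

Lemma mulmx_by_basisM l m :
  Mx (e l) *m Mx (e m) = \sum_r Mx (e l) m r *: Mx (e r).
Proof.
by rewrite -mulmx_byM mulmx_by_lincomb; apply: eq_bigr => r _; rewrite mxE.
Qed.

Lemma casimir_basis B :
  (forall l, B *m Mx (e l) = (Mx (e l))^T *m B) -> casimir X B.
Proof.
move=> BM a; rewrite mulmx_by_lincomb mulmx_sumr linear_sum mulmx_suml.
apply: eq_bigr => i _ /=; rewrite -scalemxAr BM [(_ *: _)^T]linearZ.
exact: scalemxAl.
Qed.

Lemma casimir_d0P B : casimir_d0 M B = 0 <-> casimir X B.
Proof.
by split=> [/casimir_d0_eq0/casimir_basis|hB] //; apply/casimir_d0_eq0.
Qed.

Lemma coordinates_ext (U : lmodType F) (h h' : A -> U) :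
  (forall c x y, h (g c * x + y) = c *: h x + h y) ->
  (forall c x y, h' (g c * x + y) = c *: h' x + h' y) ->
  (forall i, h (e i) = h' (e i)) -> forall x, h x = h' x.
Proof.
move=> hl hl' hh x; rewrite -[x](coordK X) /lincomb.
elim/big_rec: _ => [|i y _ IH]; last by rewrite hl hl' hh IH.
have z (f : A -> U) :
    (forall c x y, f (g c * x + y) = c *: f x + f y) -> f 0 = 0.
  move=> fl; have := fl 1 0 0; rewrite rmorph1 mul1r scale1r addr0.
  by move=> e0; apply: (addrI (f 0)); rewrite addr0 -e0.
by rewrite !z.
Qed.

Definition dual_col (x : dual g) : 'cV[F]_n := \col_i x (e i).

Lemma dual_colE (x : dual g) a : x a = (coord X a *m dual_col x) 0 0.
Proof.
rewrite mxE -{1}[a](coordK X) /lincomb.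
have x0 : x 0 = 0 by apply: (addrI (x 0)); rewrite -dualD !addr0.
rewrite (big_morph x (dualD x) x0); apply: eq_bigr => i _.
by rewrite dualZ mxE.
Qed.

Lemma dual_colD x y : dual_col (x + y) = dual_col x + dual_col y.
Proof. by apply/colP => i; rewrite !mxE. Qed.

Lemma dual_colZ a x : dual_col (a *: x) = Mx a *m dual_col x.
Proof.
apply/colP => i; rewrite mxE -[LHS]/(x (a * e i)) dual_colE -row_mulmx_by.
by rewrite -row_mul mxE.
Qed.

Fact dual_of_colD (c : 'cV[F]_n) x y :
  (coord X (x + y) *m c) 0 0 =
  (coord X x *m c) 0 0 + (coord X y *m c) 0 0.
Proof. by rewrite coordD mulmxDl mxE. Qed.

Fact dual_of_colZ (c : 'cV[F]_n) a x :
  (coord X (g a * x) *m c) 0 0 = a * (coord X x *m c) 0 0.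
Proof. by rewrite coordZ -scalemxAl mxE. Qed.

Definition dual_of_col (c : 'cV[F]_n) : dual g :=
  Dual (dual_of_colD c) (dual_of_colZ c).

Lemma dual_of_colK c : dual_col (dual_of_col c) = c.
Proof. by apply/colP => i; rewrite mxE /= coord_basis -rowE mxE. Qed.

Lemma dual_colK x : dual_of_col (dual_col x) = x.
Proof. by apply: dual_eqP => a; rewrite [RHS]dual_colE. Qed.

Lemma dual_colZr c x : dual_col (g c *: x) = c *: dual_col x.
Proof.
by rewrite dual_colZ -[g c]mulr1 mulmx_byZ mulmx_by1 -scalemxAl mul1mx.
Qed.

Lemma dual_expand x :
  x = \sum_i g (dual_col x i 0) *: dual_of_col (delta_mx i 0).
Proof.
apply: (can_inj dual_colK).
have c0 : dual_col 0 = 0 by apply/colP => i; rewrite !mxE.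
rewrite (big_morph dual_col dual_colD c0); apply/colP => i.
rewrite summxE (bigD1 i) //= big1 => [|j ij]; rewrite dual_colZr dual_of_colK.
  by rewrite !mxE !eqxx mulr1 addr0.
by rewrite !mxE eq_sym (negPf ij) mulr0.
Qed.

(** A 1-cocycle in matrix form is a bilinear cocycle v, hence v is the
    coboundary of some additive u. Since v(g c, x) = c v(1, x) = 0, the map u is
    linear over the base ring, so it has a matrix B. *)
Lemma casimir_exact V : Ext_vanishes 1 (dual g) A^o ->
  casimir_d1 M V = 0 -> exists B, V = casimir_d0 M B.
Proof.
move=> Ext0 /casimir_d1_eq0 V0.
pose W (a : A) := \sum_l coord X a 0 l *: (vec_mx (row l V) : 'M_n).
have W_linear c a b : W (g c * a + b) = c *: W a + W b.
  rewrite /W scaler_sumr -big_split; apply: eq_bigr => i _.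
  by rewrite coord_linear !mxE /= scalerDl scalerA.
have WD a b : W (a + b) = W a + W b.
  by have := W_linear 1 a b; rewrite rmorph1 mul1r scale1r.
have W0 : W 0 = 0 by apply: (addrI (W 0)); rewrite -WD !addr0.
have WZ c a : W (g c * a) = c *: W a.
  by rewrite -[g c * a]addr0 W_linear W0 addr0.
have We l : W (e l) = vec_mx (row l V).
  rewrite /W (bigD1 l) //= big1 => [|i il]; rewrite coord_basis mxE eqxx /=.
    by rewrite eqxx scale1r addr0.
  by rewrite (negPf il) scale0r.
have WM a b : W (a * b) = W b *m Mx a + (Mx b)^T *m W a.
  move: b; apply: coordinates_ext => [c x y|c x y|m].
  - by rewrite mulrDr mulrCA W_linear.
  - rewrite W_linear mulmxDl mulmx_by_linear linearP mulmxDl -!scalemxAl.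
    by rewrite scalerDr addrACA.
  move: a; apply: coordinates_ext => [c x y|c x y|l].
  - by rewrite mulrDl -mulrA W_linear.
  - rewrite mulmx_by_linear W_linear !mulmxDr -!scalemxAr.
    by rewrite scalerDr addrACA.
  rewrite !We -V0; rewrite /W; apply: eq_bigr => r _.
  by rewrite mxE.
pose v (a : A) (x : dual g) : A^o := lc ((dual_col x)^T *m W a).
have lcD p q : lc (p + q) = lc p + lc q.
  by have := lincomb_linear X 1 p q; rewrite rmorph1 mul1r scale1r.
have coord_v a x : coord X (v a x) = (dual_col x)^T *m W a.
  exact: lincombK.
have vDl a b x : v (a + b) x = v a x + v b x.
  by rewrite /v WD mulmxDr lcD.
have vDr a x y : v a (x + y) = v a x + v a y.
  by rewrite /v dual_colD linearD mulmxDl lcD.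
have vM a b x : v (a * b) x = a *: v b x + v a (b *: x).
  apply: (can_inj (coordK X)); rewrite coordD coordM !coord_v dual_colZ.
  by rewrite WM mulmxDr trmx_mul !mulmxA.
have [u [uD uE]] := Ext1_vanishes_coboundary (Cocycle vDl vDr vM) Ext0.
rewrite /= in uE.
have v1 x : v 1 x = 0 := cocycle1 (Cocycle vDl vDr vM) x.
have uZ c x : u (g c *: x) = g c * u x.
  have : v (g c) x = 0.
    rewrite /v -[g c]mulr1 WZ -scalemxAr -[_ *m _](lincombK X) -/(v 1 x) v1.
    by rewrite coord0 scaler0 lincomb0.
  by rewrite uE => /eqP; rewrite subr_eq0 => /eqP.
have u0 : u 0 = 0 by apply: (addrI (u 0)); rewrite -uD !addr0.
pose d i := dual_of_col (delta_mx i 0).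
pose B := \matrix_i coord X (u (d i)).
have coord_u x : coord X (u x) = (dual_col x)^T *m B.
  rewrite [in LHS](dual_expand x) (big_morph u uD u0) coord_sum mulmx_sum_row.
  apply: eq_bigr => i _; rewrite uZ coordZ rowK.
  by rewrite [in RHS]mxE.
exists B; apply: row_vec_mx_inj => l; rewrite casimir_d0E -We.
apply/row_matrixP => i.
have tr_d : (dual_col (d i))^T = delta_mx 0 i.
  by rewrite dual_of_colK trmx_delta.
rewrite rowE -tr_d -coord_v uE coordB coordM !coord_u dual_colZ.
by rewrite trmx_mul tr_d -!mulmxA -mulmxBr -rowE.
Qed.

End CasimirExact.

(** * Base change *)

Lemma finite_free_coordinates (P Q : comPzRingType) (f : {rmorphism P -> Q}) :
  finite_free f -> exists n, inhabited (coordinates f n).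
Proof.
move=> [n [e he]]; exists n.
have hc x := cid (he x).
pose c (x : Q) : 'rV_n := \row_i projT1 (hc x) i.
have cK : cancel c (lincomb f e).
  move=> x; rewrite /lincomb /c; case: (hc x) => d [/= xE _].
  by rewrite [RHS]xE; apply: eq_bigr => i _; rewrite mxE.
have lcK : cancel (lincomb f e) c.
  move=> v; apply/rowP => i; rewrite mxE; case: (hc _) => d [/= dE dU].
  rewrite (dU [ffun i => v 0 i]) ?ffunE //.
  by apply: eq_bigr => l _; rewrite ffunE.
by split; exact: Coordinates lcK cK.
Qed.

Section BaseChange.

Variables (P k Q R : comPzRingType) (f : {rmorphism P -> Q}).
Variables (g : {rmorphism k -> R}) (pi : {rmorphism P -> k}).
Variables (phi : {rmorphism Q -> R}).
Hypothesis square : forall a, g (pi a) = phi (f a).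
Variables (n : nat) (X : coordinates f n).

Lemma map_lincomb (c : 'rV_n) :
  phi (lincomb f (basis X) c) =
  lincomb g (fun i => phi (basis X i)) (map_mx pi c).
Proof.
rewrite /lincomb rmorph_sum; apply: eq_bigr => i _.
by rewrite rmorphM /= -square mxE.
Qed.

Definition base_change (Y : coordinates g n) : Prop :=
  forall i, basis Y i = phi (basis X i).

Lemma map_coord Y x : base_change Y -> coord Y (phi x) = map_mx pi (coord X x).
Proof.
move=> /funext eY; apply: (can_inj (lincombK Y)); rewrite coordK eY.
by rewrite -map_lincomb coordK.
Qed.

Lemma map_mulmx_by Y a : base_change Y ->
  mulmx_by Y (phi a) = map_mx pi (mulmx_by X a).
Proof.
move=> XY; apply/row_matrixP => i; rewrite -map_row !row_mulmx_by XY -rmorphM.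
exact: map_coord.
Qed.

Lemma map_gram Y t : base_change Y ->
  gram Y (map_mx pi t) = map_mx pi (gram X t).
Proof.
move=> XY; apply/row_matrixP => i; rewrite -map_row !rowK XY map_mulmx_by //.
by rewrite -map_trmx map_mxM.
Qed.

(** A basis of Q over P reduces to a basis of Q / p Q over P / p: coordinates of
    an element of p Q lie in p. *)
Lemma quotient_coordinates (p : set P) : ideal p ->
  quotient_map pi p -> quotient_map phi (extended_ideal f p) ->
  exists Y : coordinates g n, base_change Y.
Proof.
move=> hp [pi_surj pi_ker] [phi_surj phi_ker].
pose e i := phi (basis X i).
pose lift y := projT1 (cid (phi_surj y)).
have liftK y : phi (lift y) = y := projT2 (cid (phi_surj y)).
pose c y := map_mx pi (coord X (lift y)).
have cK : cancel c (lincomb g e).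
  by move=> y; rewrite -map_lincomb coordK liftK.
have ker0 x : phi x = 0 -> map_mx pi (coord X x) = 0.
  move=> /phi_ker[m [s [a [pa ->]]]].
  rewrite coord_sum [LHS](raddf_sum (map_mx pi)).
  rewrite big1 // => i _ /=; rewrite mulrC coordZ.
  by apply/rowP => l; rewrite !mxE rmorphM /= (pi_ker (a i)).2 ?mul0r.
have lcK : cancel (lincomb g e) c.
  move=> v; have [w <-] : exists w : 'rV_n, map_mx pi w = v.
    exists (\row_i projT1 (cid (pi_surj (v 0 i)))).
    by apply/rowP => i; rewrite !mxE; case: cid.
  rewrite -map_lincomb; apply/eqP; rewrite -subr_eq0 -map_mxB.
  rewrite -{2}[w](lincombK X) -coordB; apply/eqP/ker0.
  by rewrite rmorphB /= liftK subrr.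
by exists (Coordinates lcK cK).
Qed.

End BaseChange.

(** The universal property applied to b (x) c |-> b times the coordinates of c
    gives the coordinate map of K (x) Q, and its uniqueness part shows that this
    map is inverse to taking linear combinations. *)
Lemma tensor_coordinates (P K Q T : comPzRingType) (f : {rmorphism P -> Q})
    (kap : {rmorphism P -> K}) (i : {rmorphism K -> T}) (j : {rmorphism Q -> T})
    n (X : coordinates f n) :
  is_tensor_product kap f i j ->
  exists Y : coordinates i n, base_change j X Y.
Proof.
move=> [square univ]; pose e l := j (basis X l).
have [|||h hE _] := univ 'rV[K]_n (fun b c => b *: map_mx kap (coord X c)).
- by move=> b b' c; rewrite scalerDl.
- by move=> b c c'; rewrite coordD map_mxD scalerDr.
- by move=> b a c; rewrite coordZ map_mxZ scalerA.
have lcK : cancel (lincomb i e) h.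
  move=> c; rewrite /lincomb raddf_sum /=; apply/rowP => l.
  rewrite summxE (bigD1 l) //= big1 => [|m ml]; rewrite hE coord_basis !mxE.
    by rewrite !eqxx rmorph1 mulr1 addr0.
  by rewrite eq_sym (negPf ml) rmorph0 mulr0.
have [|||h0 _ h0U] := univ T (fun b c => i b * j c).
- by move=> b b' c; rewrite rmorphD mulrDl.
- by move=> b c c'; rewrite rmorphD mulrDr.
- by move=> b a c; rewrite !rmorphM square mulrA.
pose lch x := lincomb i e (h x).
have lch_additive : zmod_morphism lch.
  move=> x y; rewrite /lch raddfB /lincomb -sumrB; apply: eq_bigr => l _.
  by rewrite !mxE rmorphB mulrBl.
pose lchA : {additive T -> T} := HB.pack lch
  (GRing.isZmodMorphism.Build T T lch lch_additive).
have hK : cancel h (lincomb i e).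
  move=> x; transitivity (h0 x); last first.
    by apply/esym; apply: (h0U idfun).
  apply: (h0U lchA) => b c; rewrite /lchA /= /lch hE.
  rewrite -{2}[c](coordK X) (map_lincomb square) /lincomb mulr_sumr.
  by apply: eq_bigr => l _; rewrite !mxE rmorphM mulrA.
by exists (Coordinates lcK hK).
Qed.

(** * Units of a local ring and extension of functionals *)

(** Zorn's lemma for the property P (S0 union X) of X: the empty chain then has
    the upper bound S0, and the maximal sets lie above S0. *)
Lemma Zorn_above (T : Type) (P : set (set T)) (S0 : set T) : P S0 ->
  (forall C : set (set T), (C `<=` P)%classic -> (exists X, C X) ->
    total_on C (fun X Y => (X `<=` Y)%classic) ->
    P (\bigcup_(X in C) X)%classic) ->
  exists2 M, P M /\ (S0 `<=` M)%classic &
    forall Y, P Y -> (M `<=` Y)%classic -> (Y `<=` M)%classic.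
Proof.
move=> PS0 chain.
have [C CP Ctot|A [PA Amax]] := @Zorn_bigcup T (fun X => P (S0 `|` X)%classic).
  have [[X CX]|noC] := pselect (exists X, C X); last first.
    rewrite (_ : (_ `|` _)%classic = S0) //; apply/seteqP; split; last by left.
    by move=> x [//|[X CX _]]; case: noC; exists X.
  rewrite (_ : (_ `|` _)%classic =
      (\bigcup_(Y in [set (S0 `|` X)%classic | X in C]%classic) Y)%classic).
    apply: chain => [_ [Y CY <-]||]; first exact: CP.
      by exists (S0 `|` X)%classic; exists X.
    move=> _ _ [Y CY <-] [Z CZ <-].
    by case: (Ctot _ _ CY CZ) => YZ; [left|right]; apply: setUS.
  apply/seteqP; split=> x.
    case=> [S0x|[Y CY Yx]]; last by exists (S0 `|` Y)%classic; [exists Y|right].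
    by exists (S0 `|` X)%classic; [exists X|left].
  by move=> [_ [Y CY <-] [S0x|Yx]]; [left|right; exists Y].
exists (S0 `|` A)%classic; first by split=> // x; left.
move=> Y PY MY x Yx; apply: contrapT => nx; apply: (Amax Y); last first.
  rewrite (_ : (_ `|` _)%classic = Y) //; apply/seteqP; split=> [y [S0y|//]|y].
    by apply: MY; left.
  by right.
split=> [y Ay|YA]; first by apply: MY; right.
by apply: nx; right; apply: YA.
Qed.

Lemma local_ring_unit (P : comPzRingType) (p : set P) x :
  local_ring p -> ~ p x -> exists y, y * x = 1.
Proof.
move=> [_ [idp p1 _] uniq_p] px; apply: contrapT => nunit; apply: px.
pose proper (I : set P) := ideal I /\ ~ I 1.
have [|C CP [X CX] Ctot|m [[idm m1] mx] mmax] :=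
  @Zorn_above P proper (adjoin (@zero_ideal P) x).
- split; first by apply: adjoin_ideal; apply: zero_ideal_ideal.
  by move=> [c /subr0_eq ec]; apply: nunit; exists c.
- split; last by move=> [Y CY Y1]; have [_] := CP _ CY.
  split.
  + by exists X => //; apply: ideal0; have [] := CP _ CX.
  + move=> a b [Y CY Ya] [Z CZ Zb].
    have [YZ|ZY] := Ctot _ _ CY CZ.
      by exists Z => //; apply: idealD (YZ _ Ya) Zb; have [] := CP _ CZ.
    by exists Y => //; apply: idealD Ya (ZY _ Zb); have [] := CP _ CY.
  + move=> a b [Y CY Yb]; exists Y => //; apply: idealM Yb.
    by have [] := CP _ CY.
- have <- : m = p.
    apply: uniq_p; split=> // J idJ J1 mJ; apply/seteqP; split=> //.
    exact: mmax.
  by apply: mx; apply: mem_adjoin; apply: zero_ideal_ideal.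
Qed.

(** Zorn's lemma on graphs: a maximal linear graph is defined everywhere, since
    otherwise it could be extended by the value 0 at a missing point. *)
Lemma extend_functional (k : fieldType) (S : comPzRingType)
    (g : {rmorphism k -> S}) (A B : lmodType S) (i : {linear A -> B})
    (alpha : A -> k) :
  injective i -> (forall x y, alpha (x + y) = alpha x + alpha y) ->
  (forall c x, alpha (g c *: x) = c * alpha x) ->
  exists phi : B -> k, [/\ forall x y, phi (x + y) = phi x + phi y,
    forall c x, phi (g c *: x) = c * phi x & forall x, phi (i x) = alpha x].
Proof.
move=> i_inj aD aZ.
pose graph (G : set (B * k)) :=
  [/\ forall u v, G u -> G v -> G (u.1 + v.1, u.2 + v.2),
  forall c u, G u -> G (g c *: u.1, c * u.2) & forall c, G (0, c) -> c = 0].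
pose G0 : set (B * k) := fun u => exists x, u = (i x, alpha x).
have a0 : alpha 0 = 0 by apply: (addrI (alpha 0)); rewrite -aD !addr0.
have [|C CP [X CX] Ctot|G [[GD GZ G0c] G0G] Gmax] := @Zorn_above _ graph G0.
- split.
  + by move=> _ _ [x ->] [y ->]; exists (x + y); rewrite raddfD aD.
  + by move=> c _ [x ->]; exists (g c *: x); rewrite linearZ aZ.
  + by move=> c [x [/esym ix ->]]; move: ix; rewrite -(raddf0 i) => /i_inj ->.
- split.
  + move=> u v [Y CY Yu] [Z CZ Zv]; have [YZ|ZY] := Ctot _ _ CY CZ.
      by exists Z => //; have [ZD _ _] := CP _ CZ; apply: ZD => //; apply: YZ.
    by exists Y => //; have [YD _ _] := CP _ CY; apply: YD => //; apply: ZY.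
  + move=> c u [Y CY Yu]; exists Y => //.
    by have [_ YZ _] := CP _ CY; apply: YZ.
  + move=> c [Y CY Yc]; by have [_ _] := CP _ CY; apply.
have total b : exists c, G (b, c).
  apply: contrapT => nb.
  pose G' : set (B * k) := fun u => exists t, G (u.1 - g t *: b, u.2).
  have G'G : (G' `<=` G)%classic.
    apply: Gmax => [|u Gu]; last first.
      by exists 0; rewrite rmorph0 scale0r subr0 -surjective_pairing.
    split.
    + move=> u v [s Gu] [t Gv]; exists (s + t) => /=.
      by rewrite rmorphD scalerDl opprD addrACA; apply: GD Gu Gv.
    + move=> c u [t Gu]; exists (c * t) => /=.
      by rewrite rmorphM -scalerA -scalerBr; apply: GZ Gu.
    + move=> c [t]; have [->|t0] := eqVneq t 0.
        by rewrite rmorph0 scale0r subr0 => /G0c.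
      move=> /(GZ (- t^-1)) /= Gb; case: nb; exists (- t^-1 * c).
      by move: Gb; rewrite sub0r scalerN rmorphN scaleNr opprK scalerA -rmorphM
        mulVf // rmorph1 scale1r.
  apply: nb; exists 0; apply: G'G; exists 1 => /=.
  rewrite rmorph1 scale1r subrr -(raddf0 i) -a0; apply: G0G; by exists 0.
have Guniq b c c' : G (b, c) -> G (b, c') -> c = c'.
  move=> Gc /(GZ (-1)) Gc'; apply/eqP; rewrite -subr_eq0; apply/eqP/G0c.
  have := GD _ _ Gc Gc'; rewrite /= rmorphN rmorph1 scaleN1r subrr.
  by rewrite mulN1r.
pose phi b := projT1 (cid (total b)).
have phiP b : G (b, phi b) := projT2 (cid (total b)).
exists phi; split=> [x y|c x|x]; apply: Guniq (phiP _) _.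
- exact: GD (phiP x) (phiP y).
- exact: GZ (phiP x).
- by apply: G0G; exists x.
Qed.

(** A nondegenerate tau identifies S-linear maps M -> S with k-linear maps
    M -> k through composition with tau, so injectivity of S reduces to
    the extension of functionals. *)
Lemma injective_of_form (k : fieldType) (S : comPzRingType)
    (g : {rmorphism k -> S}) (tau : dual g) :
  (forall phi : dual g, exists x, forall a, phi a = tau (a * x)) ->
  (forall x, (forall a, tau (a * x) = 0) -> x = 0) ->
  injective_module S^o.
Proof.
move=> perfect nondeg A B i h0 i_inj.
have [||phi [phiD phiZ phiE]] :=
  @extend_functional k S g A B i (fun x => tau (h0 x)) i_inj.
- by move=> x y; rewrite raddfD; exact: dualD.
- by move=> c x; rewrite linearZ; exact: dualZ.
have lamD b x y : phi ((x + y) *: b) = phi (x *: b) + phi (y *: b).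
  by rewrite scalerDl phiD.
have lamZ b c x : phi ((g c * x) *: b) = c * phi (x *: b).
  by rewrite -scalerA phiZ.
have exx b : exists x, forall a, phi (a *: b) = tau (a * x).
  exact: (perfect (Dual (lamD b) (lamZ b))).
pose h b := projT1 (cid (exx b)).
have hE b a : phi (a *: b) = tau (a * h b) := projT2 (cid (exx b)) a.
have huniq b x : (forall a, phi (a *: b) = tau (a * x)) -> h b = x.
  move=> xE; apply/eqP; rewrite -subr_eq0; apply/eqP/nondeg => a.
  apply: (addIr (tau (a * x))); rewrite -dualD add0r -xE hE.
  by congr (tau _); ring.
have h_linear : linear (h : B -> S^o).
  move=> c x y; apply: huniq => a.
  rewrite scalerDr phiD scalerA !hE -dualD; congr (tau _).
  rewrite -[c *: (h x : S^o)]/(c * h x); ring.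
pose hL : {linear B -> S^o} := HB.pack (h : B -> S^o)
  (GRing.isLinear.Build S B S^o _ (h : B -> S^o) h_linear).
exists hL => x; apply: huniq => a.
by rewrite -linearZ phiE linearZ.
Qed.

(** * Nondegenerate functionals *)

Section Form.

Variables (F A : comPzRingType) (g : {rmorphism F -> A}) (n : nat).
Variables (X : coordinates g n) (t : 'cV[F]_n) (N : 'M[F]_n).
Hypothesis gramN : gram X t *m N = 1%:M.

Let tau := dual_of_col X t.

Lemma form_mul a x : tau (a * x) = (coord X a *m (mulmx_by X x *m t)) 0 0.
Proof. by rewrite /= mulrC coordM mulmxA. Qed.

Lemma form_represents (phi : dual g) : exists x, forall a, phi a = tau (a * x).
Proof.
pose x := lincomb g (basis X) ((dual_col X phi)^T *m N^T).
have NG : N^T *m gram X t = 1%:M.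
  by rewrite -[gram X t]tr_gram -trmx_mul gramN trmx1.
exists x => a; rewrite form_mul (dual_colE X); congr ((_ *m _) _ _).
apply: trmx_inj; rewrite -coord_gram lincombK -mulmxA NG.
by rewrite mulmx1.
Qed.

Lemma form_nondegenerate x : (forall a, tau (a * x) = 0) -> x = 0.
Proof.
move=> x0; apply: (can_inj (coordK X)); rewrite coord0.
rewrite -[coord X x]mulmx1 -gramN mulmxA coord_gram.
have -> : mulmx_by X x *m t = 0.
  apply/colP => i; rewrite [RHS]mxE -(x0 (basis X i)) form_mul coord_basis.
  by rewrite -rowE [RHS]mxE.
by rewrite trmx0 mul0mx.
Qed.

(** An invertible Gram matrix makes tau a generator of the dual with zero
    annihilator. *)
Lemma frobenius_of_gram : finite_free g -> frobenius g.
Proof.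
move=> freeg; split=> //.
pose h phi := projT1 (cid (form_represents phi)).
have hE (phi : dual g) a : phi a = tau (a * h phi).
  exact: projT2 (cid (form_represents phi)) a.
have huniq (phi : dual g) x : (forall a, phi a = tau (a * x)) -> h phi = x.
  move=> xE; apply/eqP; rewrite -subr_eq0; apply/eqP/form_nondegenerate => a.
  apply: (addIr (tau (a * x))); rewrite -dualD add0r -xE (hE phi).
  by congr (tau _); ring.
have h_linear : linear (h : dual g -> A^o).
  move=> c phi psi; apply: huniq => a.
  rewrite -[LHS]/(phi (c * a) + psi a) (hE phi) (hE psi) -dualD; congr (tau _).
  rewrite -[c *: (h phi : A^o)]/(c * h phi); ring.
pose hL : {linear dual g -> A^o} := HB.pack (h : dual g -> A^o)
  (GRing.isLinear.Build A (dual g) A^o _ (h : dual g -> A^o) h_linear).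
exists hL; exists (fun x => x *: tau) => [phi|x] /=.
  by apply: dual_eqP => a; rewrite -[LHS]/(tau (h phi * a)) mulrC -hE.
by apply: huniq => a; rewrite -[LHS]/(tau (x * a)) mulrC.
Qed.

End Form.

(** * Gorenstein algebras from nondegenerate functionals *)

Lemma injective_finite_dimension (S : comPzRingType) (M : lmodType S) :
  injective_module M -> finite_injective_dimension M.
Proof.
move=> injM; pose E n : lmodType S := if n is 0%N then M else 'rV[S]_0.
have E0 n (x : E n.+1) : x = 0 by apply: thinmx0.
pose z n : {linear E n -> E n.+1} := \0.
pose eta : {linear M -> E 0%N} := idfun.
exists E, eta, z; split; last by exists 0%N => -[|n] // _ x; exact: E0.
split=> [[|n]|||].
- exact: injM.
- by move=> A B i h _; exists \0 => x; rewrite [RHS]E0.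
- by [].
- by move=> x; split=> // _; exists x.
- by move=> n x; split=> [_|_]; [exists 0; rewrite [RHS]E0|exact: E0].
Qed.

Section LocalRing.

Variables (R : comPzRingType) (q : prime_ideal R).
Local Notation fr a := (to_loc_at q a).

(** The only candidate for the maximal ideal of a local ring. *)
Definition nonunits (S : comPzRingType) : set S :=
  fun z => ~ exists c, c * z = 1.

Lemma noetherian_loc_at : noetherian R -> noetherian (loc_at q).
Proof.
move=> noethR I hI.
have [n [gen genE]] := noethR _ (contraction_ideal hI).
exists n, (fun i => fr (gen i)) => z; split=> [Iz|[c ->]]; last first.
  apply: ideal_sum => // i; apply: idealM => //.
  by apply/(genE (gen i)); exists (fun j => (j == i)%:R); rewrite (bigD1 i) //=
    eqxx mul1r big1 ?addr0 // => j /negPf ->; rewrite mul0r.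
have [a [u [uq za]]] := loc_at_fraction z; have [v vu] := loc_at_unit uq.
have [c aE] := (genE a).1 ((loc_at_mem hI uq za).1 Iz).
exists (fun i => v * fr (c i)).
rewrite -[z]mul1r -vu -mulrA [fr u * z]mulrC za aE rmorph_sum mulr_sumr.
by apply: eq_bigr => i _; rewrite rmorphM mulrA.
Qed.

Lemma nonunits_ideal : ideal (@nonunits (loc_at q)).
Proof.
have mem z : nonunits z -> exists a u v,
    [/\ prime_set q a, ~ prime_set q u, v * fr u = 1 & z * fr u = fr a].
  move=> hz; have [a [u [uq za]]] := loc_at_fraction z.
  have [v vu] := loc_at_unit uq; exists a, u, v; split=> //.
  apply: contrapT => /loc_at_unit[w wa]; apply: hz; exists (w * fr u).
  by rewrite -mulrA [fr u * z]mulrC za.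
have of_mem a u z : prime_set q a -> ~ prime_set q u -> z * fr u = fr a ->
    nonunits z.
  move=> qa uq za [c cz]; have /loc_at_proper := qa; apply.
  have [v vu] := loc_at_unit uq; exists (v * c).
  by rewrite -za [v * c]mulrC mulrACA cz mul1r vu.
have hq := prime_ideal_ideal q.
split.
- apply: (of_mem 0 1 _ (ideal0 hq) (prime_ideal_proper (p := q))).
  by rewrite rmorph0 mul0r.
- move=> x y /mem[a [u [v [qa uq _ xa]]]] /mem[b [w [z [qb wq _ yb]]]].
  apply: (of_mem (w * a + u * b) (u * w)).
  + by apply: idealD => //; apply: idealM.
  + by case/prime_ideal_mul.
  + rewrite rmorphD !rmorphM -xa -yb; ring.
- move=> x y /mem[b [w [z [qb wq _ yb]]]].
  have [a [u [uq xa]]] := loc_at_fraction x.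
  apply: (of_mem (a * b) (u * w)); first exact: idealM.
    by case/prime_ideal_mul.
  by rewrite !rmorphM -xa -yb; ring.
Qed.

Lemma local_ring_loc_at : noetherian R -> local_ring (@nonunits (loc_at q)).
Proof.
move=> noethR; have hM := nonunits_ideal.
have M1 : ~ @nonunits (loc_at q) 1 by apply; exists 1; rewrite mulr1.
have proper_sub (J : set (loc_at q)) : ideal J -> ~ J 1 ->
    (J `<=` @nonunits (loc_at q))%classic.
  by move=> hJ J1 x Jx [c cx]; apply: J1; rewrite -cx; apply: idealM.
split; first exact: noetherian_loc_at.
  by split=> // J hJ J1 MJ; apply/seteqP; split=> //; apply: proper_sub.
move=> m [hm m1 mmax]; apply/esym/mmax => //; exact: proper_sub.
Qed.

End LocalRing.

(** For q a prime, take u outside q with u R minimal. Then every element outside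
    q divides u in the sense u = w v u, so localizing at q is the quotient of R
    by the annihilator of u, isomorphic to u R. The functional
    a/1 |-> tau(u a) is nondegenerate on it, so it is self-injective. *)
Lemma gorenstein_of_form (k : fieldType) (R : comPzRingType)
    (g : {rmorphism k -> R}) n (X : coordinates g n) t :
  gram X t \in unitmx -> gorenstein R.
Proof.
move=> tU; have noethR := noetherian_coordinates X; split=> // q.
split; first by exists (@nonunits (loc_at q)); apply: local_ring_loc_at.
apply: injective_finite_dimension.
have [|u uq umax] := ex_maximal_adjoin (P := fun x => ~ prime_set q x)
  (finite_length_coordinates X) (@zero_ideal_ideal R).
  by exists 1; exact: prime_ideal_proper.
have uv v : ~ prime_set q v -> exists w, u = w * v * u.
  move=> vq; have [|c /subr0_eq] := umax v; last by exists c.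
  by case/prime_ideal_mul.
pose fr : {rmorphism R -> loc_at q} := to_loc_at q.
have frP a b : fr a = fr b <-> u * a = u * b.
  split=> [/loc_at_eq[v vq ab]|ab]; last by apply/loc_at_eq; exists u.
  have [w uE] := uv v vq; rewrite uE.
  have -> : w * v * u * a = w * u * (v * a) by ring.
  by rewrite ab; ring.
have fr_surj z : exists a, z = fr a.
  have [b [v [vq zb]]] := loc_at_fraction z; have [w uE] := uv v vq.
  exists (w * b); rewrite rmorphM -[fr b]zb.
  have wv : fr (w * v) = 1.
    by rewrite -(rmorph1 fr); apply/frP; rewrite mulr1 {2}uE; ring.
  by rewrite mulrCA -rmorphM wv mulr1.
pose num z := projT1 (cid (fr_surj z)).
have numK z : fr (num z) = z := esym (projT2 (cid (fr_surj z))).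
pose tau := dual_of_col X t; have gramN := mulmxV tU.
pose gq : {rmorphism k -> loc_at q} := fr \o g.
have tauE a z : z = fr a -> tau (u * num z) = tau (u * a).
  by move=> za; congr (tau _); apply/frP; rewrite numK.
have tauD x y : tau (u * num (x + y)) = tau (u * num x) + tau (u * num y).
  rewrite (tauE (num x + num y)); last by rewrite rmorphD !numK.
  by rewrite mulrDr dualD.
have tauZ c x : tau (u * num (gq c * x)) = c * tau (u * num x).
  rewrite (tauE (g c * num x)); last by rewrite rmorphM numK.
  by rewrite mulrCA dualZ.
apply: (@injective_of_form k _ gq (Dual tauD tauZ)) => [phi|z z0]; last first.
  rewrite -[z]numK -(rmorph0 fr); apply/frP; rewrite mulr0.
  apply: (form_nondegenerate gramN) => a.
  have := z0 (fr a); rewrite -[LHS]/(tau (u * num (fr a * z))).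
  rewrite (tauE (a * num z)); last by rewrite rmorphM numK.
  by move=> <-; congr (tau _); ring.
have phiD a b : phi (fr (a + b)) = phi (fr a) + phi (fr b).
  by rewrite rmorphD dualD.
have phiZ c a : phi (fr (g c * a)) = c * phi (fr a).
  by rewrite rmorphM; exact: (dualZ phi).
have [x xE] := form_represents gramN (Dual phiD phiZ); rewrite /= in xE.
have [w uE] := uv u uq.
have xu : x = u * (w * x).
  apply/eqP; rewrite -subr_eq0; apply/eqP/(form_nondegenerate gramN) => a.
  have -> : a * (x - u * (w * x)) = (a * (1 - w * u)) * x by ring.
  rewrite /= -[LHS]xE; have -> : fr (a * (1 - w * u)) = fr 0.
    by apply/frP; rewrite mulr0 mulrCA mulrBr mulr1 {1}uE; ring.
  by apply: (addrI (phi (fr 0))); rewrite -dualD -rmorphD !addr0.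
exists (fr (w * x)) => z; rewrite -[z in LHS]numK [LHS]xE.
rewrite -[RHS]/(tau _) (tauE (num z * (w * x))); last first.
  by rewrite (rmorphM fr (num z)) numK.
by congr (tau _); rewrite {1}xu; ring.
Qed.

(** * Symmetry of Casimir elements and the theorem *)

(** A Gorenstein algebra over a field has a multiplicity-free socle, hence its
    dual is cyclic. *)
Lemma casimir_sym_of_gorenstein (k : fieldType) (T : comPzRingType)
    (g : {rmorphism k -> T}) n (X : coordinates g n) B :
  gorenstein T -> casimir X B -> B^T = B.
Proof.
move=> gorT; have flT := finite_length_coordinates X.
have [t /mulmxV tV] :=
  ex_nondegenerate_form X (gorenstein_multiplicity_free_socle flT gorT).
exact: casimir_gram_sym tV.
Qed.

Lemma casimir_base_change (P k Q R : comPzRingType) (f : {rmorphism P -> Q})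
    (g : {rmorphism k -> R}) (pi : {rmorphism P -> k})
    (phi : {rmorphism Q -> R})
    n (X : coordinates f n) (Y : coordinates g n) B :
  (forall a, g (pi a) = phi (f a)) -> base_change phi X Y ->
  casimir X B -> casimir Y (map_mx pi B).
Proof.
move=> sq XY hB; apply: casimir_basis => l.
by rewrite XY (map_mulmx_by sq _ XY) -map_mxM hB map_mxM map_trmx.
Qed.

(** Exactness at degree 1 over the residue field is the hypothesis on Ext. *)
Lemma lift_casimir_of_Ext (P : comPzRingType) (k : fieldType)
    (Q R : comPzRingType) (f : {rmorphism P -> Q})
    (g : {rmorphism k -> R}) (pi : {rmorphism P -> k})
    (phi : {rmorphism Q -> R})
    n (X : coordinates f n) (Y : coordinates g n) :
  (forall y, exists x, pi x = y) ->
  (forall x, pi x != 0 -> exists y, y * x = 1) ->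
  (forall a, g (pi a) = phi (f a)) -> base_change phi X Y ->
  Ext_vanishes 1 (dual g) R^o ->
  forall B, casimir Y B -> exists2 B', map_mx pi B' = B & casimir X B'.
Proof.
move=> pi_surj pi_local sq XY Ext0 B hB.
have ME : (fun l => map_mx pi (mulmx_by X (basis X l))) =
          (fun l => mulmx_by Y (basis Y l)).
  by apply/funext => l; rewrite XY (map_mulmx_by sq _ XY).
have [||V||B' BE /casimir_d0P B'0] := lift_casimir
    (M := fun l => mulmx_by X (basis X l)) pi_surj pi_local _ _ _ (B := B) _.
- exact: mulmx_by_basisC.
- exact: mulmx_by_basisM.
- by rewrite ME => /(casimir_exact Ext0).
- by rewrite ME; apply/casimir_d0P.
by exists B'.
Qed.

(* (P, p, k) is the local ring, with residue map piP; f : P -> Q is the given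
   homomorphism; K is k(q) = P_q / q P_q and T is K \otimes_P Q; R is Q / p Q,
   a k-algebra through fk. *)
Theorem theorem6p1
    (P : comPzRingType) (p : set P) (k : fieldType) (piP : {rmorphism P -> k})
    (P_local : local_ring p) (k_residue : quotient_map piP p)
    (Q : comPzRingType) (f : {rmorphism P -> Q})
    (Q_free : finite_free f)
    (Q_fibre : exists (q : prime_ideal P)
        (K : fieldType) (piK : {rmorphism loc_at q -> K})
        (T : comPzRingType) (i : {rmorphism K -> T}) (j : {rmorphism Q -> T}),
      [/\ quotient_map piK (extended_ideal (to_loc_at q) q),
          is_tensor_product (piK \o to_loc_at q) f i j &
          gorenstein T])
    (R : comPzRingType) (piQ : {rmorphism Q -> R})
    (R_quotient : quotient_map piQ (extended_ideal f p))
    (fk : {rmorphism k -> R}) (fk_induced : forall a, fk (piP a) = piQ (f a))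
    (Ext_zero : Ext_vanishes 1 (dual fk) R^o) :
  gorenstein R /\ frobenius f.
Proof.
have [n [X]] := finite_free_coordinates Q_free.
have [q [K [piK [T [i [j [_ tensT gorT]]]]]]] := Q_fibre.
pose kap : {rmorphism P -> K} := piK \o to_loc_at q.
have [Z XZ] := @tensor_coordinates P K Q T f kap i j n X tensT.
have idp : ideal p by case: P_local => _ [].
have [Y XY] := quotient_coordinates fk_induced X idp k_residue R_quotient.
have piP_surj := k_residue.1.
have piP_local x : piP x != 0 -> exists y, y * x = 1.
  move=> x0; apply: local_ring_unit P_local _ => /(k_residue.2 x) e.
  by rewrite e eqxx in x0.
have kap_piP x : kap x = 0 -> piP x = 0.
  move=> x0; apply: contrapT => /eqP/piP_local[y yx]; have := congr1 kap yx.
  by rewrite rmorphM x0 mulr0 rmorph1 => /esym/eqP; rewrite oner_eq0.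
have sym B : casimir Y B -> B^T = B.
  move=> /(lift_casimir_of_Ext piP_surj piP_local fk_induced XY Ext_zero).
  move=> [B' <- /(casimir_base_change tensT.1 XZ)].
  move=> /(casimir_sym_of_gorenstein gorT) B'T.
  apply/matrixP => a b; rewrite !mxE; apply/eqP; rewrite -subr_eq0 -rmorphB.
  apply/eqP/kap_piP; rewrite rmorphB; apply/eqP; rewrite subr_eq0; apply/eqP.
  by have /matrixP/(_ a b) := B'T; rewrite !mxE.
have socR := multiplicity_free_socle_of_casimir_sym sym.
have [t tU] := ex_nondegenerate_form Y socR.
split; first exact: gorenstein_of_form tU.
have [t' tE] := lift_matrix piP_surj t.
rewrite -tE (map_gram fk_induced _ XY) in tU.
have [N gramN _] := invertible_of_residue piP_local tU.
exact: frobenius_of_gram gramN Q_free.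
Qed.
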